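(* Let $C \subseteq \mathbb R^4$ be a symmetric convex body of revolution containing the centered closed unit Euclidean ball $\mathbb B_4$ in its interior, and suppose there is a constant $A$ such that $|C\cap H|_3 = A$ for every hyperplane $H$ tangent to $\mathbb B_4$. If $A \in \mathbb A$ (the explicit set defined in the context), then $C$ is a Euclidean ball.
   Context: A convex body is a compact convex set with non-empty interior; symmetric means $C=-C$; a body of revolution is invariant under all rotations fixing pointwise some line (which passes through the origin when $C$ is symmetric). $|\cdot|_3$ is $3$-dimensional Lebesgue measure in $H$. Definition of $\mathbb A$. Let $\omega_3=\frac43\pi$. For $A>0$ let $R_A>0$ be given by $A=\omega_3(R_A^2-1)^{3/2}$ (with $R_A>1$), and $\gamma_A=\frac1\pi\arctan\big(\sqrt{R_A^2-1}\big)=\frac1\pi\arctan\big((A/\omega_3)^{1/3}\big)$. For $x>1$ let $G_A(x)=\arctan(\sqrt{x^2-1})-\arctan(\sqrt{R_A^2-1})$. For $\alpha,\beta\in(0,\pi/2)$, $\alpha\ne\beta$, let $$F_{A,+}(\alpha,\beta)=G_A\!\left(R_A\frac{\sin(\alpha-\beta)}{\sin\alpha-\sin\beta}\right),\qquad F_{A,-}(\alpha)=-G_A(R_A\cos\alpha)$$ (the latter whenever $R_A\cos\alpha>1$). For $k\ge1$ let $\delta_{A,k}=\pi\min_{j\in\mathbb Z}|(2k-1)\gamma_A-j|$. For $k\ge2$ let $\alpha_{A,k}=\min\{\delta_{A,1},\dots,\delta_{A,k}\}$ and $\beta_{A,k}=\min\big(\{\delta_{A,1},\dots,\delta_{A,k}\}\setminus\{\alpha_{A,k}\}\big)$.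 Condition $C(A,k)$ (for $k\ge 2$) is the pair of inequalities $$F_{A,+}(\alpha_{A,k},\beta_{A,k})<\delta_{A,k+1},\qquad F_{A,-}(\alpha_{A,k})<\delta_{A,k+1}.$$ $\mathbb A$ is the set of all $A>8\omega_3$ such that $\gamma_A$ is irrational and condition $C(A,k)$ holds for every $k\ge2$. (For $A>8\omega_3$ with $\gamma_A$ irrational, all quantities occurring in $C(A,k)$, $k\ge2$, are well defined.) *)

(* Defs.v *)
From HB Require Import structures.
From mathcomp Require Import all_boot all_order all_algebra.
From mathcomp Require Import all_classical all_reals all_analysis.

Set Implicit Arguments.
Unset Strict Implicit.
Unset Printing Implicit Defensive.

Import Order.TTheory GRing.Theory Num.Theory.
Import numFieldNormedType.Exports.

Local Open Scope classical_set_scope.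
Local Open Scope ring_scope.

(** R^4 is ['rV[R]_4].  Its library norm is the sup norm, which only serves for
    the (canonical) topology; the Euclidean structure is defined here. *)
Section Euclidean.
Variable R : realType.

Definition dot n (x y : 'rV[R]_n) : R := \sum_(i < n) x 0 i * y 0 i.

Definition enorm n (x : 'rV[R]_n) : R := Num.sqrt (dot x x).

Definition closed_eball n (c : 'rV[R]_n) (r : R) : set 'rV[R]_n :=
  [set x | enorm (x - c) <= r].

Definition is_hyperplane n (H : set 'rV[R]_n) : Prop :=
  exists (u : 'rV[R]_n) (t : R), u != 0 /\ H = [set x | dot u x = t].

(** A hyperplane is tangent to a convex body with smooth boundary iff it
    supports it: it meets the body but not its interior. *)
Definition tangent_hyperplane n (H B : set 'rV[R]_n) : Prop :=
  [/\ is_hyperplane H, H `&` B !=set0 & H `&` B° = set0].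

Definition is_line n (L : set 'rV[R]_n) : Prop :=
  exists p d : 'rV[R]_n, d != 0 /\ L = range (fun t : R => p + t *: d).

(** Orientation-preserving rigid motions, acting on row vectors; those with a
    fixed point are the rotations about an arbitrary centre. *)
Definition is_direct_isometry n (f : 'rV[R]_n -> 'rV[R]_n) : Prop :=
  exists (c : 'rV[R]_n) (Q : 'M[R]_n),
    [/\ Q *m Q^T = 1%:M, \det Q = 1 & forall x, f x = c + x *m Q].

Definition convex_body n (C : set 'rV[R]_n) : Prop :=
  [/\ compact C, convex_set (C : set (convex_lmodType 'rV[R]_n)) & C° !=set0].

Definition symmetric_set n (C : set 'rV[R]_n) : Prop := -%R @` C = C.

(** The axis [L] is an affine line. *)
Definition of_revolution n (C : set 'rV[R]_n) : Prop :=
  exists L : set 'rV[R]_n, is_line L /\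
    forall f : 'rV[R]_n -> 'rV[R]_n, is_direct_isometry f ->
      (forall x, L x -> f x = x) -> f @` C = C.

End Euclidean.

Section HyperplaneMeasure.
Variable R : realType.

Definition lebesgue3 : set (R * R * R) -> \bar R :=
  ((@lebesgue_measure R \x @lebesgue_measure R) \x @lebesgue_measure R)%E.

Definition vec3 (y : R * R * R) : 'rV[R]_3 :=
  \row_i [:: y.1.1; y.1.2; y.2]`_i.

Definition affine_map3 (f : 'rV[R]_4 * 'M[R]_(3, 4)) (y : R * R * R) :
  'rV[R]_4 := f.1 + vec3 y *m f.2.

(** Isometric affine parametrizations of [H] by R^3: a base point and a 3 x 4
    matrix with orthonormal rows. *)
Definition frames (H : set 'rV[R]_4) : set ('rV[R]_4 * 'M[R]_(3, 4)) :=
  [set f | f.2 *m f.2^T = 1%:M /\ range (affine_map3 f) = H].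

(** 3-dimensional Lebesgue measure in the hyperplane [H], transported by an
    isometric parametrization of [H]; the choice is immaterial because Lebesgue
    measure on R^3 is invariant under isometries.  [vol3 H] is meaningful only
    when [H] is a hyperplane. *)
Definition vol3 (H S : set 'rV[R]_4) : \bar R :=
  lebesgue3 (affine_map3 (get (frames H)) @^-1` S).

End HyperplaneMeasure.

Section SetAA.
Variable R : realType.
Implicit Types A : R.

Definition omega3 : R := 4 / 3 * pi.

(** The solution R_A > 1 of A = omega3 * (R_A ^ 2 - 1) ^ (3/2); see [RAP]. *)
Definition RA A : R := Num.sqrt (1 + (A / omega3) `^ (2 / 3)).

Lemma RAP A r : 0 < A -> 1 < r ->
  r = RA A <-> A = omega3 * (r ^+ 2 - 1) `^ (3 / 2).
Proof.
move=> A0 r1.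
have w0 : 0 < omega3 by rewrite mulr_gt0// ?pi_gt0// divr_gt0.
have r0 : 0 <= r by rewrite ltW// (lt_trans ltr01).
have s0 : 0 <= r ^+ 2 - 1 by rewrite subr_ge0 expr_ge1// ltW.
have e1 : (2 / 3 * (3 / 2) = 1 :> R).
  by rewrite mulrA divfK ?divff// pnatr_eq0.
have e2 : (3 / 2 * (2 / 3) = 1 :> R) by rewrite mulrC.
have Aw : 0 <= A / omega3 by rewrite divr_ge0// ltW.
split=> [rE|AE].
- have -> : r ^+ 2 - 1 = (A / omega3) `^ (2 / 3).
    by rewrite rE sqr_sqrtr ?addr_ge0 ?powR_ge0// addrC addKr.
  by rewrite -powRrM e1 powRr1// mulrC divfK// gt_eqF.
- rewrite /RA AE [omega3 * _]mulrC mulfK ?gt_eqF// -powRrM e2 powRr1// addrC subrK.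
  by rewrite sqrtr_sqr ger0_norm.
Qed.

Definition gamma A : R := pi^-1 * atan (Num.sqrt (RA A ^+ 2 - 1)).

Definition G A (x : R) : R :=
  atan (Num.sqrt (x ^+ 2 - 1)) - atan (Num.sqrt (RA A ^+ 2 - 1)).

Definition Fplus A (a b : R) : R :=
  G A (RA A * (sin (a - b) / (sin a - sin b))).

Definition Fminus A (a : R) : R := - G A (RA A * cos a).

(** Here and below every infimum is over a set on which it is attained (a
    distance to the integers, or a nonempty finite set), hence is a minimum. *)
Definition delta A (k : nat) : R :=
  pi * inf (range (fun j : int => `|(2 * k%:R - 1) * gamma A - j%:~R|)).

Definition deltas A (k : nat) : set R :=
  [set delta A i | i in [set i : nat | (1 <= i <= k)%N]].

Definition alpha A (k : nat) : R := inf (deltas A k).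

Definition beta A (k : nat) : R := inf (deltas A k `\` [set alpha A k]).

Definition condC A (k : nat) : Prop :=
  Fplus A (alpha A k) (beta A k) < delta A k.+1 /\
  Fminus A (alpha A k) < delta A k.+1.

Definition AA : set R :=
  [set A | [/\ 8 * omega3 < A, irrational (gamma A) &
    forall k : nat, (2 <= k)%N -> condC A k]].

End SetAA.

(* Main.v *)
(** The profile [q] of [C] gives the squared radius of its slices orthogonal to
    the axis; dimension 4 is special in that the slices of a hyperplane section
    are discs, so the volume of the section by the tangent hyperplane of angle
    [t] is [pi] times the integral of the positive part of [q s - tau t s ^ 2],
    where only the polynomial [tau t] depends on [t].  Integrating over the
    chord cut out at angle [t] bounds the volume at a nearby angle [t'] from
    below, with equality at [t' = t]; equating derivatives gives
      2/3 cos t (a^3 + b^3) + sin t (a^2 - b^2) = (A / pi) cos t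
    for the two parts [a], [b] of the chord, with no regularity needed on [C].
    When one of them is [L = sqrt (R_A^2 - 1)] the equation leaves one spurious
    value for the other, and condition [C(A, k)] with convexity excludes it.
    So the boundary of the profile meets the circle of radius [R_A] at [pi *
    gamma_A], hence at all its odd multiples, which are dense. *)

Require Import Defs.
From HB Require Import structures.
From mathcomp Require Import all_boot all_order all_algebra.
From mathcomp Require Import all_classical all_reals all_analysis.
From mathcomp Require Import measurable_realfun ring lra zify.
Import Order.TTheory GRing.Theory Num.Theory.
Import numFieldNormedType.Exports.

Set Implicit Arguments.
Unset Strict Implicit.
Unset Printing Implicit Defensive.

Local Open Scope classical_set_scope.
Local Open Scope ring_scope.

(** * Lebesgue measure on lines, planes and space *)

(** Put [r = sqrt (1 + L^2)] and [psi = atan L]. The tangent line of angle [t] meets the circle of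
    radius [r] at the polar angles [t - psi] and [t + psi], at distance [L] from the point of
    tangency, so each tangent line can carry a boundary point on the circle to another one [2 psi]
    away. The two directions differ. With [t] folded into [(0, pi / 2)], the cofactor left by the
    chord equation is positive on the way from [t - psi] to [t + psi]; only the way back has a
    spurious root, and [tan t] lies between that root and [L]. As the tangent line crosses the axis
    at distance [tan t], all depends on whether the axis point [1 / cos t] is in the profile. Circle
    points already reached decide this: the line through two of them, at angles [alpha] and [beta],
    bounds the axis from outside ([Fplus]), and the chord from one to its mirror image bounds it
    from inside ([Fminus]). The first step has a single such point; there [A > 8 omega3], that is
    [L > 2], excludes the spurious root. *)

Section LebesgueAffine.
Variable R : realType.
Notation mu := (@lebesgue_measure R).

Definition affine1 (a b x : R) : R := a * x + b.

Lemma measurable_affine1 (a b : R) : measurable_fun setT (affine1 a b).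
Proof. by apply: measurable_funD => //; exact: measurable_funM. Qed.

HB.instance Definition _ (a b : R) :=
  isMeasurableFun.Build _ _ _ _ _ (measurable_affine1 a b).

(** By uniqueness of Lebesgue measure, compared on half-open intervals; for [a < 0] the preimage is
    closed at the other end, hence the two cases. *)
Lemma lebesgue_affine1 (a b : R) (E : set R) : a != 0 -> measurable E ->
  mu (affine1 a b @^-1` E) = (`|a|^-1%:E * mu E)%E.
Proof.
move=> a0 mE.
have na : 0 < `|a| by rewrite normr_gt0.
pose k : {nonneg R} := NngNum (ltW na).
suff -> : mu E = mscale k (pushforward mu (affine1 a b : _ -> measurableTypeR R)) E.
- exact: measurable_affine1.
- by move=> mm; rewrite /mscale /= /pushforward muleA -EFinM mulVf ?gt_eqF// mul1e.
move=> mf; apply: lebesgue_measure_unique => // X [[x y] /= _ <-].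
rewrite /mscale /= /pushforward lebesgue_measure_itv /=.
have [a_gt0|a_lt0|/eqP] := ltgtP 0 a; last by rewrite eq_sym (negbTE a0).
- have -> : affine1 a b @^-1` `]x, y]%classic = `](x - b) / a, (y - b) / a]%classic.
    apply/seteqP; split => z /=; rewrite /affine1 !in_itv /=.
      by rewrite ltr_pdivrMr// ler_pdivlMr// ltrBlDr lerBrDr mulrC.
    by rewrite ltr_pdivrMr// ler_pdivlMr// ltrBlDr lerBrDr mulrC.
  rewrite lebesgue_measure_itv /= !lte_fin ltr_pM2r ?invr_gt0// ltrD2r.
  case: ifP => xy; last by rewrite mule0.
  rewrite gtr0_norm// -!EFinB -EFinM; congr EFin; field; exact: lt0r_neq0.
- have -> : affine1 a b @^-1` `]x, y]%classic = `[(y - b) / a, (x - b) / a[%classic.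
    apply/seteqP; split => z /=; rewrite /affine1 !in_itv /=.
      by rewrite ler_ndivrMr// ltr_ndivlMr// ltrBlDr lerBrDr mulrC andbC.
    by rewrite ler_ndivrMr// ltr_ndivlMr// ltrBlDr lerBrDr mulrC andbC.
  rewrite lebesgue_measure_itv /= !lte_fin ltr_nM2r ?invr_lt0// ltrD2r.
  case: ifP => xy; last by rewrite mule0.
  rewrite ltr0_norm// -!EFinB -EFinM; congr EFin; field; exact: ltr0_neq0.
Qed.

Lemma integral_affine1 (a b : R) (f : R -> \bar R) : a != 0 ->
  measurable_fun setT f -> (forall x, 0 <= f x)%E ->
  (\int[mu]_x f (affine1 a b x) = `|a|^-1%:E * \int[mu]_x f x)%E.
Proof.
move=> a0 mf f0.
have na : 0 <= `|a|^-1 by rewrite invr_ge0.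
pose k : {nonneg R} := NngNum na.
have /= := @ge0_integral_pushforward _ _ (measurableTypeR R) (measurableTypeR R)
  R (affine1 a b) (measurable_affine1 a b) mu setT f measurableT mf (fun x _ => f0 x).
rewrite preimage_setT => <-.
rewrite -[X in (X * _)%E]/(k%:num%:E) -ge0_integral_mscale//.
apply: eq_measure_integral; first exact: measurable_affine1.
by move=> mm A mA _; exact: lebesgue_affine1.
Qed.

End LebesgueAffine.

Section ProductMeasure.
Context d1 d2 (T1 : measurableType d1) (T2 : measurableType d2) (R : realType).
Variables (m1 : {sigma_finite_measure set T1 -> \bar R})
  (m2 : {sigma_finite_measure set T2 -> \bar R}).
Local Open Scope ereal_scope.

Lemma product_measure12 (E : set (T1 * T2)) : measurable E ->
  (m1 \x m2) E = (m1 \x^ m2) E.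
Proof.
move=> mE; apply: product_measure_unique => // A B mA mB.
exact: product_measure2E.
Qed.

(** Cavalieri's principle, with sections over the first factor here and over the second below;
    measure-preserving maps of space are built from it one coordinate at a time. *)
Lemma eq_product_measure_xsection (E F : set (T1 * T2)) :
  (forall x, m2 (xsection E x) = m2 (xsection F x)) ->
  (m1 \x m2) E = (m1 \x m2) F.
Proof. by move=> EF; apply: eq_integral => x _ /=. Qed.

Lemma eq_product_measure_ysection (E F : set (T1 * T2)) :
  measurable E -> measurable F ->
  (forall y, m1 (ysection E y) = m1 (ysection F y)) ->
  (m1 \x m2) E = (m1 \x m2) F.
Proof.
move=> mE mF EF; rewrite !product_measure12//.
by apply: eq_integral => y _ /=.
Qed.

End ProductMeasure.

Lemma measurable_le_fun d (T : measurableType d) (R : realType) (f g : T -> R) :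
  measurable_fun setT f -> measurable_fun setT g ->
  measurable [set x | f x <= g x].
Proof.
move=> mf mg.
rewrite [X in measurable X](_ : _ = setT `&` (g \- f)%R @^-1` `[0, +oo[%classic).
  exact: (measurable_funB mg mf).
by apply/seteqP; split => x /=; rewrite in_itv/= andbT subr_ge0 // => -[].
Qed.

Ltac mfun := repeat first
  [ assumption | exact: measurable_cst | exact: measurable_id
  | exact: measurable_fst | exact: measurable_snd
  | apply: measurable_fun_pair | apply: measurable_funD | apply: measurable_funB
  | apply: measurable_funM | apply: measurable_funX | apply: measurable_funN
  | apply: (measurableT_comp measurable_fst)
  | apply: (measurableT_comp measurable_snd)
  | match goal with H : measurable_fun _ ?h |- measurable_fun _ (fun y => ?h _) =>
      apply: (measurableT_comp H) end ].

Section LebesguePlaneSpace.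
Variable R : realType.
Local Notation mu := (@lebesgue_measure R).

Definition lebesgue2 : set (measurableTypeR R * measurableTypeR R) -> \bar R :=
  (mu \x mu)%E.

HB.instance Definition _ := Measure.on lebesgue2.

(* The library's sigma-finite instance on products is shadowed by its
   subprobability instance. *)
Lemma lebesgue2_sigma_finite : sigma_finite setT lebesgue2.
Proof.
pose F (n : nat) : set (measurableTypeR R) := `[- n%:R, n%:R]%classic.
exists (fun n => F n `*` F n) => [|n].
  apply/seteqP; split => // -[x y] _.
  exists (Num.truncn (`|x| + `|y|)).+1 => //; rewrite /F /= !in_itv /= -!ler_norml.
  have := truncnS_gt (`|x| + `|y|); have := normr_ge0 x; have := normr_ge0 y.
  by split; lra.
split; first by apply: measurableX; exact: measurable_itv.
have mF : (mu (F n) < +oo)%E.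
  by rewrite lebesgue_measure_itv /=; case: ifP => _; rewrite ltry.
have Foo : mu (F n) \is a fin_num by rewrite ge0_fin_numE.
rewrite /lebesgue2 product_measure1E; [|exact: measurable_itv|exact: measurable_itv].
exact: (lte_mul_pinfty _ Foo mF).
Qed.

HB.instance Definition _ :=
  Measure_isSigmaFinite.Build _ _ _ lebesgue2 lebesgue2_sigma_finite.

Local Notation mu2 := lebesgue2.

Lemma measurable_preimageT d d' (T : measurableType d) (T' : measurableType d')
  (f : T -> T') (E : set T') : measurable_fun setT f -> measurable E ->
  measurable (f @^-1` E).
Proof. by move=> mf mE; rewrite -[_ @^-1` _]setTI; exact: mf. Qed.

Lemma lebesgue2_translation (c : R * R) (E : set (R * R)) : measurable E ->
  mu2 ((fun p => (p.1 + c.1, p.2 + c.2)) @^-1` E) = mu2 E.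
Proof.
move=> mE.
have m1 : measurable ((fun p : R * R => (p.1, p.2 + c.2)) @^-1` E).
  apply: measurable_preimageT => //; mfun.
transitivity (mu2 ((fun p : R * R => (p.1, p.2 + c.2)) @^-1` E)).
  apply: eq_product_measure_ysection => // [|y].
    by apply: measurable_preimageT => //; mfun.
  rewrite -[RHS]mul1e -[1%E]/((1 : R)%:E) -[1%R]invr1 -[X in (X^-1)]normr1.
  rewrite -(lebesgue_affine1 c.1 (oner_neq0 R) (measurable_ysection y m1)).
  congr (mu _); apply/seteqP; split => x /=; rewrite /ysection /affine1 /= !inE /= mul1r//.
apply: eq_product_measure_xsection => x.
rewrite -[RHS]mul1e -[1%E]/((1 : R)%:E) -[1%R]invr1 -[X in (X^-1)]normr1.
rewrite -(lebesgue_affine1 c.2 (oner_neq0 R) (measurable_xsection x mE)).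
by congr (mu _); apply/seteqP; split => y /=; rewrite /xsection /affine1 /= !inE /= mul1r.
Qed.

Local Notation mu3 := (lebesgue2 \x mu)%E.

Lemma lebesgue3_translation (c : R * R * R) (E : set (R * R * R)) : measurable E ->
  mu3 ((fun p => (p.1.1 + c.1.1, p.1.2 + c.1.2, p.2 + c.2)) @^-1` E) = mu3 E.
Proof.
move=> mE.
have m1 : measurable ((fun p : R * R * R => (p.1, p.2 + c.2)) @^-1` E).
  apply: measurable_preimageT => //; mfun.
transitivity (mu3 ((fun p : R * R * R => (p.1, p.2 + c.2)) @^-1` E)).
  apply: eq_product_measure_ysection => [||z].
  - by apply: measurable_preimageT; [mfun|exact: mE].
  - exact: m1.
  apply: etrans (lebesgue2_translation c.1 (measurable_ysection z m1)).
  congr (mu2 _); apply/seteqP; split => x /=; rewrite /ysection /= !inE //.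
apply: eq_product_measure_xsection => x.
rewrite -[RHS]mul1e -[1%E]/((1 : R)%:E) -[1%R]invr1 -[X in (X^-1)]normr1.
rewrite -(lebesgue_affine1 c.2 (oner_neq0 R) (measurable_xsection x mE)).
by congr (mu _); apply/seteqP; split => y /=; rewrite /xsection /affine1 /= !inE /= mul1r.
Qed.

Lemma lebesgue3_shear (a b : R) (E : set (R * R * R)) : measurable E ->
  mu3 ((fun p => (p.1.1, p.1.2, p.2 + (a * p.1.1 + b * p.1.2))) @^-1` E) = mu3 E.
Proof.
move=> mE; apply: eq_product_measure_xsection => -[x y].
rewrite -[RHS]mul1e -[1%E]/((1 : R)%:E) -[1%R]invr1 -[X in (X^-1)]normr1.
rewrite -(lebesgue_affine1 (a * x + b * y) (oner_neq0 R) (measurable_xsection (x, y) mE)).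
by congr (mu _); apply/seteqP; split => z /=; rewrite /xsection /affine1 /= !inE /= mul1r.
Qed.

Lemma lebesgue3_flip_shear (a b : R) (E : set (R * R * R)) : measurable E ->
  mu3 ((fun p => (p.1.1 + a * p.2, p.1.2 + b * p.2, - p.2)) @^-1` E) = mu3 E.
Proof.
move=> mE.
have m1 : measurable ((fun p : R * R * R => (p.1, - p.2)) @^-1` E).
  apply: measurable_preimageT => //; mfun.
transitivity (mu3 ((fun p : R * R * R => (p.1, - p.2)) @^-1` E)).
  apply: eq_product_measure_ysection => [||z].
  - by apply: measurable_preimageT; [mfun|exact: mE].
  - exact: m1.
  apply: etrans (lebesgue2_translation (a * z, b * z) (measurable_ysection z m1)).
  congr (mu2 _); apply/seteqP; split => x /=; rewrite /ysection /= !inE //.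
apply: eq_product_measure_xsection => x.
have n0 : (-1 : R) != 0 by rewrite oppr_eq0 oner_eq0.
rewrite -[RHS]mul1e -[1%E]/((1 : R)%:E) -[1%R]invr1 -[X in (X^-1)]normr1 -[X in (X^-1)]normrN.
rewrite -(lebesgue_affine1 0 n0 (measurable_xsection x mE)).
by congr (mu _); apply/seteqP; split => y /=; rewrite /xsection /affine1 /= !inE /= mulN1r addr0.
Qed.

(** The reflection exchanging [n] with the third basis vector is a shear, then a shear with a sign
    change, then a shear; each preserves volume by Cavalieri's principle. The case [n3 = 1] stands
    apart because the slopes have denominator [n3 - 1]. *)
Lemma lebesgue3_axial (h : R -> R) (n1 n2 n3 : R) : measurable_fun setT h ->
  n1 ^+ 2 + n2 ^+ 2 + n3 ^+ 2 = 1 ->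
  mu3 [set y | y.1.1 ^+ 2 + y.1.2 ^+ 2 + y.2 ^+ 2 <=
               h (n1 * y.1.1 + n2 * y.1.2 + n3 * y.2)] =
  mu3 [set y | y.1.1 ^+ 2 + y.1.2 ^+ 2 + y.2 ^+ 2 <= h y.2].
Proof.
move=> mh n_unit.
have [n31|n31] := eqVneq n3 1.
  have n10 : n1 = 0 by apply/eqP; rewrite -sqrf_eq0; apply/eqP; nra.
  have n20 : n2 = 0 by apply/eqP; rewrite -sqrf_eq0; apply/eqP; nra.
  by rewrite n31 n10 n20; congr (mu3 _); apply/seteqP; split => y /=; rewrite !mul0r !add0r mul1r.
have d0 : n3 - 1 != 0 by rewrite subr_eq0.
set S := [set y : R * R * R | _ <= h (_ + _)].
pose al := n1 / (n3 - 1); pose be := n2 / (n3 - 1).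
have mS : measurable S.
  apply: measurable_le_fun; first by mfun.
  apply: (measurableT_comp mh); mfun.
pose S1 := (fun p : R * R * R => (p.1.1, p.1.2, p.2 + (- al * p.1.1 + - be * p.1.2))) @^-1` S.
have mS1 : measurable S1 by apply: measurable_preimageT => //; mfun.
pose S2 := (fun p : R * R * R => (p.1.1 + n1 * p.2, p.1.2 + n2 * p.2, - p.2)) @^-1` S1.
have mS2 : measurable S2 by apply: measurable_preimageT => //; mfun.
(* With [e3] the third basis vector, [w] is the inner product of the point with [n - e3], divided by
   [n3 - 1]. The composite adds [w (n - e3)] to the point: this is the reflection exchanging [n] and
   [e3]. *)
have key x y z w z' : w = z + (al * x + be * y) ->
    z' = - w + (- al * (x + n1 * w) + - be * (y + n2 * w)) ->
    n1 * (x + n1 * w) + n2 * (y + n2 * w) + n3 * z' = z /\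
    (x + n1 * w) ^+ 2 + (y + n2 * w) ^+ 2 + z' ^+ 2 = x ^+ 2 + y ^+ 2 + z ^+ 2.
  move=> wE z'E.
  have aE : (n3 - 1) * al = n1 by rewrite /al; field.
  have bE : (n3 - 1) * be = n2 by rewrite /be; field.
  have {}wE : (n3 - 1) * w = (n3 - 1) * z + n1 * x + n2 * y.
    by rewrite wE -[in RHS]aE -[in RHS]bE; ring.
  have {}z'E : z' = z + (n3 - 1) * w.
    apply: (mulfI d0); rewrite [RHS]mulrDr.
    have -> : (n3 - 1) * z = (n3 - 1) * w - n1 * x - n2 * y by rewrite wE; ring.
    transitivity (- ((n3 - 1) * w) - ((n3 - 1) * al) * (x + n1 * w)
      - ((n3 - 1) * be) * (y + n2 * w)); first by rewrite z'E; ring.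
    rewrite aE bE; transitivity (- ((n3 - 1) * w) - n1 * x - n2 * y
      - (n1 ^+ 2 + n2 ^+ 2 + n3 ^+ 2 - n3 ^+ 2) * w); first by ring.
    by rewrite n_unit; ring.
  rewrite z'E; split.
    transitivity (n1 * x + n2 * y + n3 * z + (n1 ^+ 2 + n2 ^+ 2 + n3 ^+ 2 - n3) * w);
      [ring | rewrite n_unit; lra].
  transitivity (x ^+ 2 + y ^+ 2 + z ^+ 2 + 2 * w * ((n3 - 1) * z + n1 * x + n2 * y) +
      w ^+ 2 * (n1 ^+ 2 + n2 ^+ 2 + n3 ^+ 2 + 1 - 2 * n3));
    [ring | rewrite n_unit -wE; ring].
rewrite -(lebesgue3_shear (- al) (- be) mS) -(lebesgue3_flip_shear n1 n2 mS1).
rewrite -(lebesgue3_shear al be mS2); congr (mu3 _).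
apply/seteqP; split => -[[x y] z] /=; rewrite /S2 /S1 /S /=.
all: by have [-> ->] := key x y z _ _ erefl erefl.
Qed.

Lemma lebesgue_sqr_le (c : R) :
  mu [set y | y ^+ 2 <= c] = (2 * Num.sqrt c)%:E.
Proof.
have [c0|c0] := leP 0 c.
  rewrite [X in mu X](_ : _ = `[- Num.sqrt c, Num.sqrt c]%classic).
    rewrite lebesgue_measure_itv /= lte_fin; case: ifP => [_|].
      by rewrite -EFinB; congr EFin; ring.
    move=> /negbT; rewrite -leNgt => h.
    have h0 := sqrtr_ge0 c.
    have -> : Num.sqrt c = 0 by lra.
    by rewrite mulr0.
  apply/seteqP; split => y /=; rewrite in_itv /=.
    by move=> h; rewrite -ler_norml -sqrtr_sqr ler_sqrt.
  by rewrite -ler_norml -sqrtr_sqr ler_sqrt.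
rewrite ltr0_sqrtr// mulr0 [X in mu X](_ : _ = set0) ?measure0//.
by apply/seteqP; split => y //= h; have := sqr_ge0 y; lra.
Qed.

Lemma derivable_sinM (r : R) : derivable_oo_LRcontinuous (fun t : R => r * sin t) (- (pi / 2)) (pi / 2).
Proof.
have c (x : R) : {for x, continuous (fun t : R => r * sin t)}.
  by apply: cvgM; [exact: cvg_cst|exact: continuous_sin].
by split => [x _||]; [apply: derivableM => //; exact: derivable_sin
  |exact/cvg_at_right_filter/c|exact/cvg_at_left_filter/c].
Qed.

Lemma integral_half_disc (r : R) : 0 < r ->
  (\int[mu]_(x in `[(- r)%R, r]) (2 * Num.sqrt (r ^+ 2 - x ^+ 2))%:E = (pi * r ^+ 2)%:E)%E.
Proof.
move=> r0; have p0 := pi_gt0 R.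
have dF : (fun t : R => r * sin t)^`()%classic = (fun t => r * cos t).
  apply/funext => x; rewrite derive1E; apply: derive_val.
have cc : continuous (fun t : R => r * cos t).
  by move=> x; apply: cvgM; [exact: cvg_cst|exact: continuous_cos].
have cG : continuous (fun x : R => 2 * Num.sqrt (r ^+ 2 - x ^+ 2)).
  move=> x; apply: cvgM; first exact: cvg_cst.
  apply: continuous_comp; last exact: sqrt_continuous.
  by apply: cvgB; [exact: cvg_cst|exact: exprn_continuous].
have := @integration_by_substitution_increasing R (fun t => r * sin t)
  (fun x => 2 * Num.sqrt (r ^+ 2 - x ^+ 2)) (- (pi / 2)) (pi / 2).
rewrite sinN sin_pihalf mulrN mulr1 dF => ->; first last.
- exact: continuous_subspaceT.
- exact: derivable_sinM.
- by apply: cvgP; apply: cvg_at_left_filter; exact: cc.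
- by apply: cvgP; apply: cvg_at_right_filter; exact: cc.
- by move=> x _; exact: cc.
- by move=> x y xI yI xy; rewrite ltr_pM2l// ltr_sin.
- lra.
pose F (t : R) : R := r ^+ 2 * (t + sin t * cos t).
have dFt (t : R) : is_derive t 1 F (2 * r ^+ 2 * cos t ^+ 2).
  apply: is_derive_eq.
  rewrite /GRing.scale /=; have := cos2Dsin2 t => h.
  have -> : cos t ^+ 2 = 1 - sin t ^+ 2 by lra.
  by nra.
have cF : continuous F.
  move=> t; have := dFt t => dt; exact/differentiable_continuous/derivable1_diffP.
have cf : continuous (fun x : R => 2 * r ^+ 2 * cos x ^+ 2).
  move=> t; apply: cvgM; first exact: cvg_cst.
  by apply: (@continuous_comp _ _ _ cos (fun x => x ^+ 2)); [exact: continuous_cos|exact: exprn_continuous].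
transitivity (\int[mu]_(x in `[(- (pi / 2))%R, (pi / 2)%R]) (2 * r ^+ 2 * cos x ^+ 2)%:E)%E.
  apply: eq_integral => t; rewrite inE /= in_itv /= => /andP[t1 t2]; congr EFin; rewrite fctE /=.
  have -> : r ^+ 2 - (r * sin t) ^+ 2 = (r * cos t) ^+ 2.
    by rewrite !exprMn cos2sin2; ring.
  rewrite sqrtr_sqr ger0_norm; first by ring.
  by apply: mulr_ge0; [exact: ltW|apply: cos_ge0_pihalf; rewrite t1 t2].
rewrite (@continuous_FTC2 R _ F).
- by rewrite -EFinB /F; congr EFin; rewrite sinN cosN cos_pihalf sin_pihalf; field.
- lra.
- exact: continuous_subspaceT.
- by split; [move=> t _; have := dFt t => -[]|exact/cvg_at_right_filter/cF|exact/cvg_at_left_filter/cF].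
- by move=> t _; rewrite derive1E; apply: derive_val.
Qed.

Lemma lebesgue2_disc (c : R) :
  mu2 [set p | p.1 ^+ 2 + p.2 ^+ 2 <= c] = (pi * Num.max 0 c)%:E.
Proof.
transitivity (\int[mu]_x (2 * Num.sqrt (c - x ^+ 2))%:E)%E.
  apply: eq_integral => x _ /=.
  rewrite -lebesgue_sqr_le; congr (mu _).
  by apply/seteqP; split => y /=; rewrite /xsection /= inE /= lerBrDl.
have [c0|c0] := leP c 0.
  rewrite mulr0 integral0_eq// => x _.
  by rewrite ler0_sqrtr ?mulr0//; have := sqr_ge0 x; lra.
have rE := sqr_sqrtr (ltW c0); set r := Num.sqrt c in rE.
have r0 : 0 < r by rewrite sqrtr_gt0.
rewrite -rE -integral_half_disc// [RHS]integral_mkcond.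
apply: eq_integral => x _; rewrite patchE; case: ifPn => //.
rewrite notin_setE /= in_itv /= => /negP; rewrite -ler_norml -ltNge => h.
rewrite ler0_sqrtr ?mulr0// subr_le0 -[leRHS](real_normK (num_real x)).
by have := normr_ge0 x; nra.
Qed.

Lemma lebesgue3_axial_integral (h : R -> R) : measurable_fun setT h ->
  mu3 [set y | y.1.1 ^+ 2 + y.1.2 ^+ 2 + y.2 ^+ 2 <= h y.2] =
  (\int[mu]_z (pi * Num.max 0 (h z - z ^+ 2))%:E)%E.
Proof.
move=> mh; rewrite product_measure12.
  apply: eq_integral => z _ /=; rewrite -lebesgue2_disc; congr (mu2 _).
  by apply/seteqP; split => y /=; rewrite /ysection /= inE /= lerBrDr.
by apply: measurable_le_fun; mfun; apply: (measurableT_comp mh); mfun.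
Qed.

End LebesguePlaneSpace.

(** * The chord equation *)

Section ChordIdentity.
Variable R : realType.
Local Notation mu := (@lebesgue_measure R).

Lemma integral_quadratic (k0 k1 k2 x y : R) : x <= y ->
  (\int[mu]_(s in `[x, y]) (k0 + k1 * s + k2 * s ^+ 2)%:E =
   (k0 * (y - x) + k1 * (y ^+ 2 - x ^+ 2) / 2 + k2 * (y ^+ 3 - x ^+ 3) / 3)%:E)%E.
Proof.
rewrite le_eqVlt => /predU1P[->|xy].
  by rewrite set_itv1 integral_set1; congr EFin; ring.
pose F (s : R) : R := k0 * s + k1 / 2 * s ^+ 2 + k2 / 3 * s ^+ 3.
have dF (t : R) : is_derive t 1 F (k0 + k1 * t + k2 * t ^+ 2).
  by apply: is_derive_eq; rewrite /GRing.scale /=; field.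
have cF : continuous F.
  move=> t; have := dF t => dt; exact/differentiable_continuous/derivable1_diffP.
have cf : continuous (fun s : R => k0 + k1 * s + k2 * s ^+ 2).
  move=> t; apply: cvgD; [apply: cvgD|].
  - exact: cvg_cst.
  - by apply: cvgM; [exact: cvg_cst|exact: cvg_id].
  - by apply: cvgM; [exact: cvg_cst|exact: exprn_continuous].
rewrite (@continuous_FTC2 R _ F) //.
- by rewrite -EFinB /F; congr EFin; field.
- exact: continuous_subspaceT.
- by split; [move=> t _; have := dF t => -[]|exact/cvg_at_right_filter/cF|exact/cvg_at_left_filter/cF].
- by move=> t _; rewrite derive1E; apply: derive_val.
Qed.

(** Stationarity at [t], multiplied by [sin t ^ 3]. In the application [k0] and [k1] come from the
    moments of a fixed chord, so the function being minimized is smooth whatever [q] is. *)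
Lemma derivative_at_min (A k0 k1 t : R) : 0 < t < pi ->
  (forall x, 0 < x < pi ->
     A * sin t + (k0 - k1 * cos t) * (sin t)^-1 ^+ 2 <=
     A * sin x + (k0 - k1 * cos x) * (sin x)^-1 ^+ 2) ->
  A * cos t * sin t ^+ 3 + k1 * sin t ^+ 2 + 2 * k1 * cos t ^+ 2 = 2 * k0 * cos t.
Proof.
move=> t0p tmin.
pose D (x : R) : R := A * sin x + (k0 - k1 * cos x) * (sin x)^-1 ^+ 2.
have s0 (x : R) : 0 < x < pi -> sin x != 0 by move=> xp; rewrite gt_eqF// sin_gt0_pi.
have dD (x : R) : 0 < x < pi -> is_derive x 1 D (A * cos x + k1 * sin x * (sin x)^-1 ^+ 2
     - (k0 - k1 * cos x) * (2 * (sin x)^-1 * ((sin x)^-1 ^+ 2 * cos x))).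
  move=> xp; have sx := s0 x xp.
  have dV : is_derive x 1 (fun x : R => (sin x)^-1) (- sin x ^- 2 *: cos x).
    exact: is_deriveV.
  apply: is_derive_eq; rewrite /GRing.scale /=.
  by field.
have := @derive1_at_min R D 0 pi t (pi_ge0 R).
case.
- by move=> x; rewrite in_itv /= => xp; have [] := dD x xp.
- by rewrite in_itv.
- by move=> x; rewrite in_itv /= => xp; exact: tmin.
move=> _; have [_ ->] := dD t t0p => /eqP.
have st := s0 t t0p.
move=> /eqP h; have := congr1 ( *%R ^~ (sin t ^+ 3)) h; rewrite mul0r.
have -> : (A * cos t + k1 * sin t * (sin t)^-1 ^+ 2
     - (k0 - k1 * cos t) * (2 * (sin t)^-1 * ((sin t)^-1 ^+ 2 * cos t))) * sin t ^+ 3 =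
   A * cos t * sin t ^+ 3 + k1 * sin t ^+ 2 + 2 * k1 * cos t ^+ 2 - 2 * k0 * cos t by field.
by move/eqP; rewrite subr_eq0 => /eqP.
Qed.

Variables (q : R -> R) (A : R).
Hypothesis mq : measurable_fun setT q.
Hypothesis sec : forall t : R, (\int[mu]_z (pi * Num.max 0
  (q (cos t - z * sin t) - (sin t + z * cos t) ^+ 2))%:E = A%:E)%E.

(* the height of the tangent line with normal (cos t, sin t) above s *)
Let tau t s : R := (1 - s * cos t) / sin t.
Let f t s : R := pi * Num.max 0 (q s - tau t s ^+ 2).

Let f_ge0 t s : 0 <= f t s.
Proof. by rewrite mulr_ge0 ?pi_ge0// le_max lexx. Qed.

Let mf t : measurable_fun setT (f t).
Proof.
apply: measurable_funM => //; apply: measurable_maxr => //.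
apply: measurable_funB => //; apply: measurable_funX; rewrite /tau.
by apply: measurable_funM => //; apply: measurable_funB => //; apply: measurable_funM.
Qed.

Let mEf t : measurable_fun setT (EFin \o f t).
Proof. exact/measurable_EFinP. Qed.

(** Here [z] is arc length along the tangent line and [s = cos t - z sin t] the axis coordinate; the
    change of variable contributes the factor [sin t], and makes the term [q s] common to all
    angles. *)
Let int_f t : 0 < sin t -> (\int[mu]_s (f t s)%:E = (A * sin t)%:E)%E.
Proof.
move=> st; have s0 : - sin t != 0 by rewrite oppr_eq0 gt_eqF.
have f0 s : (0 <= (EFin \o f t) s)%E by rewrite lee_fin.
have := integral_affine1 (cos t) s0 (mEf t) f0.
rewrite normrN (gtr0_norm st) /=.
under eq_integral => z _.
  have -> : f t (affine1 (- sin t) (cos t) z) =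
      pi * Num.max 0 (q (cos t - z * sin t) - (sin t + z * cos t) ^+ 2).
    rewrite /f /affine1 /tau.
    have -> : - sin t * z + cos t = cos t - z * sin t by ring.
    have -> : (1 - (cos t - z * sin t) * cos t) / sin t = sin t + z * cos t.
      apply: (mulIf (lt0r_neq0 st)); rewrite divfK ?gt_eqF//.
      by have := cos2Dsin2 t; nra.
    by [].
  over.
rewrite sec => h.
have -> : (A * sin t)%:E = ((sin t)%:E * A%:E)%E by rewrite -EFinM mulrC.
by rewrite h muleA -EFinM mulfV ?gt_eqF// mul1e.
Qed.

Let integrable_f t : 0 < sin t -> mu.-integrable setT (EFin \o f t).
Proof.
move=> st; apply/integrableP; split.
  exact: mEf.
have -> : (\int[mu]_x `|(EFin \o f t) x| = \int[mu]_s (f t s)%:E)%E.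
  by apply: eq_integral => s _ /=; rewrite ger0_norm.
by rewrite int_f// ltry.
Qed.

(** On the chord of angle [t] the unknown [q] cancels from the difference of the two integrands,
    leaving [pi (tau t ^ 2 - tau t' ^ 2)], quadratic in [s]. Restricting the integral at [t'] to
    that chord and dropping the positive part can only decrease it. *)
Lemma first_variation_ge0 t t' x y : 0 < sin t -> 0 < sin t' -> x <= y ->
  (forall s, (tau t s ^+ 2 <= q s) = (x <= s <= y)) ->
  let p0 := (sin t)^-1 in let p' := (sin t')^-1 in
  A * sin t + pi * ((p0 ^+ 2 - p' ^+ 2) * (y - x)
    - 2 * (p0 ^+ 2 * cos t - p' ^+ 2 * cos t') * ((y ^+ 2 - x ^+ 2) / 2)
    + (p0 ^+ 2 - p' ^+ 2) * ((y ^+ 3 - x ^+ 3) / 3)) <= A * sin t'.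
Proof.
move=> st st' xy qt /=; set p0 := (sin t)^-1; set p' := (sin t')^-1.
pose k0 := pi * (p0 ^+ 2 - p' ^+ 2).
pose k1 := pi * (- 2 * (p0 ^+ 2 * cos t - p' ^+ 2 * cos t')).
have mI : measurable (`[x, y]%classic : set (measurableTypeR R)) by exact: measurable_itv.
have IT : `[x, y]%classic `<=` [set: R] by [].
have fI : (\int[mu]_(s in `[x, y]) (f t s)%:E = (A * sin t)%:E)%E.
  rewrite -int_f// integral_mkcond; apply: eq_integral => s _; rewrite patchE.
  case: ifPn => //; rewrite notin_setE /= in_itv /= -qt => /negP.
  rewrite -ltNge => h; congr EFin; rewrite /f max_l ?mulr0//; lra.
have cP : continuous (fun s : R => k0 + k1 * s + k0 * s ^+ 2).
  move=> s; apply: cvgD; [apply: cvgD|].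
  - exact: cvg_cst.
  - by apply: cvgM; [exact: cvg_cst|exact: cvg_id].
  - by apply: cvgM; [exact: cvg_cst|exact: exprn_continuous].
have iP : mu.-integrable `[x, y] (EFin \o (fun s : R => k0 + k1 * s + k0 * s ^+ 2)).
  apply: continuous_compact_integrable; first exact: segment_compact.
  exact: continuous_subspaceT.
have ifI : mu.-integrable `[x, y] (EFin \o f t).
  exact: integrableS (integrable_f st).
have if'I : mu.-integrable `[x, y] (EFin \o f t').
  exact: integrableS (integrable_f st').
have := le_integral mI (integrableD mI ifI iP) if'I.
rewrite integralD// fI integral_quadratic// => le1.
have le2 : (\int[mu]_(s in `[x, y]) (f t' s)%:E <= (A * sin t')%:E)%E.
  rewrite -int_f//; apply: ge0_subset_integral => //.
  - exact: mEf.
  - by move=> s _; rewrite lee_fin.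
have {le1} : ((A * sin t)%:E + (k0 * (y - x) + k1 * (y ^+ 2 - x ^+ 2) / 2 +
    k0 * (y ^+ 3 - x ^+ 3) / 3)%:E <= (A * sin t')%:E)%E.
  apply: le_trans le2; apply: le1 => s; rewrite inE /= in_itv /= -qt => qs.
  rewrite -EFinD lee_fin.
  (* The term [- s ^ 2] is the same for all angles and cancels; what remains has equal constant and
     quadratic coefficients, hence [k0] in both places. *)
  have tauE u : 0 < sin u -> tau u s ^+ 2 = (sin u)^-1 ^+ 2 * (1 - 2 * s * cos u + s ^+ 2)
      - s ^+ 2.
    move=> su; rewrite /tau.
    rewrite {1}(_ : s ^+ 2 = s ^+ 2 * (cos u ^+ 2 + sin u ^+ 2)); last first.
      by rewrite cos2Dsin2 mulr1.
    by field; rewrite gt_eqF.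
  have -> : f t s = pi * (q s - tau t s ^+ 2) by rewrite /f max_r// subr_ge0.
  have : pi * (q s - tau t' s ^+ 2) <= f t' s.
    by rewrite /f ler_pM2l ?pi_gt0// le_max lexx orbT.
  apply: le_trans; rewrite !tauE// le_eqVlt; apply/orP; left; apply/eqP.
  by rewrite /k0 /k1 /p0 /p'; ring.
rewrite -EFinD lee_fin; apply: le_trans.
by rewrite le_eqVlt; apply/orP; left; apply/eqP; rewrite /k0 /k1; field.
Qed.

Lemma chord_identity t a b : 0 < t < pi -> - b <= a ->
  (forall z, ((sin t + z * cos t) ^+ 2 <= q (cos t - z * sin t)) = (- b <= z <= a)) ->
  A * cos t = pi * (2 / 3 * cos t * (a ^+ 3 + b ^+ 3) + sin t * (a ^+ 2 - b ^+ 2)).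
Proof.
move=> tp ab hz.
have st : 0 < sin t by exact: sin_gt0_pi.
(* Axis coordinates of the two ends of the chord; [z = a] gives the smaller one because
   [sin t > 0]. *)
pose x := cos t - a * sin t; pose y := cos t + b * sin t.
have xy : x <= y by rewrite /x /y; nra.
have c2 : cos t ^+ 2 = 1 - sin t ^+ 2 by rewrite -cos2sin2.
have qt s : (tau t s ^+ 2 <= q s) = (x <= s <= y).
  pose z := (cos t - s) / sin t.
  have sE : s = cos t - z * sin t by rewrite /z divfK ?gt_eqF//; ring.
  have tE : tau t s = sin t + z * cos t.
    apply: (mulIf (lt0r_neq0 st)); rewrite /tau divfK ?gt_eqF// sE.
    transitivity (cos t ^+ 2 + sin t ^+ 2 - (cos t - z * sin t) * cos t).
      by rewrite cos2Dsin2.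
    ring.
  transitivity ((sin t + z * cos t) ^+ 2 <= q (cos t - z * sin t)).
    by rewrite tE -sE.
  rewrite hz /z ler_pdivlMr// ler_pdivrMr// /x /y andbC.
  by congr (_ && _); apply/idP/idP; lra.
(* Moments of the chord of orders 0, 1 and 2, constant while the comparison angle [u] varies. *)
pose I0 := y - x; pose I1 := (y ^+ 2 - x ^+ 2) / 2; pose I2 := (y ^+ 3 - x ^+ 3) / 3.
have /(_ _)/wrap[] := @derivative_at_min A (pi * (I0 + I2)) (2 * pi * I1) t tp.
  move=> u up; have su : 0 < sin u by exact: sin_gt0_pi.
  have := first_variation_ge0 st su xy qt; rewrite /= -/I0 -/I1 -/I2.
  lra.
have -> : I1 = (2 * cos t * sin t * (a + b) + sin t ^+ 2 * (b ^+ 2 - a ^+ 2)) / 2.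
  by rewrite /I1 /x /y; field.
have -> : I0 + I2 = sin t * (a + b) * (cos t ^+ 2 + sin t ^+ 2) + (3 * cos t ^+ 2 * sin t * (a + b)
   + 3 * cos t * sin t ^+ 2 * (b ^+ 2 - a ^+ 2) + sin t ^+ 3 * (a ^+ 3 + b ^+ 3)) / 3.
  by rewrite cos2Dsin2 /I0 /I2 /x /y; field.
move=> h; apply: (mulIf (lt0r_neq0 (exprn_gt0 3 st))).
lra.
Qed.

End ChordIdentity.

(** * Infima and irrational numbers *)

Section NumberTheory.
Variable R : realType.

Lemma odd_pos (i : nat) : (1 <= i)%N -> (0 < 2 * i - 1)%N /\ (0 < 4 * i - 2)%N.
Proof. lia. Qed.

Lemma natr_odd (i : nat) : (1 <= i)%N -> 2 * i%:R - 1 = (2 * i - 1)%:R :> R.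
Proof. by move=> i1; rewrite natrB ?natrM//; lia. Qed.

Lemma natr_odd2 (i : nat) : (1 <= i)%N -> (2 * i%:R - 1) * 2 = (4 * i - 2)%:R :> R.
Proof. by move=> i1; rewrite natrB ?natrM; [ring|lia]. Qed.

Lemma int_eq1 (j : int) : 0%:~R < j%:~R :> R -> j%:~R < 2%:~R :> R -> j = 1.
Proof. by rewrite !ltr_int; lia. Qed.

Lemma inf_attained (E : set R) (x : R) : E x -> (forall y, E y -> x <= y) -> inf E = x.
Proof.
move=> Ex lbx; apply/eqP; rewrite eq_le; apply/andP; split.
  by apply: ge_inf => //; exists x.
by apply: lb_le_inf; [exists x|].
Qed.

Lemma inf_finite_image (F : nat -> R) (P : set nat) (k : nat) :
  (forall i, P i -> (i <= k)%N) -> P !=set0 ->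
  exists i, [/\ P i, inf (F @` P) = F i & forall j, P j -> F i <= F j].
Proof.
move=> Pk [i0 Pi0].
have i0k : (i0 < k.+1)%N by rewrite ltnS Pk.
have P0 : (fun i : 'I_k.+1 => `[< P i >]) (Ordinal i0k) by apply/asboolP.
case: (@arg_minP _ R _ (Ordinal i0k) (fun i : 'I_k.+1 => `[< P i >]) (fun i => F i) P0).
move=> i /asboolP Pi mini.
have mn j : P j -> F i <= F j.
  move=> Pj; have jk : (j < k.+1)%N by rewrite ltnS Pk.
  by apply: (mini (Ordinal jk)); apply/asboolP.
exists i; split => //; apply: inf_attained; first by exists i.
by move=> _ [j Pj <-]; exact: mn.
Qed.

Lemma inf_dist_int (x : R) : exists j : int,
  [/\ inf (range (fun i : int => `|x - i%:~R|)) = `|x - j%:~R|,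
   forall i : int, `|x - j%:~R| <= `|x - i%:~R| & `|x - j%:~R| <= 2^-1].
Proof.
have fl : (Num.floor x)%:~R <= x by exact: floor_le.
have fu : x < (Num.floor x)%:~R + 1 by have := floorD1_gt x; rewrite intrD.
set f := Num.floor x in fl fu.
have dist i : (i%:~R <= f%:~R :> R) || (f%:~R + 1 <= i%:~R :> R).
  by case: (leP i f) => h; rewrite ?ler_int ?h// orbC -intrD1 ler_int lezD1 h.
have [h|h] := leP (x - f%:~R) 2^-1.
  have mn (i : int) : `|x - f%:~R| <= `|x - i%:~R|.
    by case/orP: (dist i) => hi; case: (ger0P (x - f%:~R)); case: (ger0P (x - i%:~R)); lra.
  exists f; split => //; last by rewrite ger0_norm; lra.
  by apply: inf_attained; [exists f|move=> _ [i _ <-]].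
have mn (i : int) : `|x - (f + 1)%:~R| <= `|x - i%:~R|.
  rewrite intrD.
  by case/orP: (dist i) => hi; case: (ger0P (x - (f%:~R + 1%:~R))); case: (ger0P (x - i%:~R)); lra.
exists (f + 1); split => //; last by rewrite intrD ler0_norm; lra.
by apply: inf_attained; [exists (f + 1)|move=> _ [i _ <-]].
Qed.

(** If the group generated by [a] and [1] had no positive element below [e], the infimum [g] of its
    positive elements would generate it, and [a] would be a quotient of two integer multiples of
    [g]. *)
Lemma irrational_int_dense (a : R) : irrational a -> forall x e : R, 0 < e ->
  exists m n : int, `|x - (m%:~R * a + n%:~R)| < e.
Proof.
move=> irr x e e0.
pose H (y : R) := exists m n : int, y = m%:~R * a + n%:~R.
have HB (y z : R) : H y -> H z -> H (y - z).
  move=> [m [n ->]] [m' [n' ->]]; exists (m - m'), (n - n').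
  by rewrite !intrB; ring.
have HM (y : R) (k : int) : H y -> H (k%:~R * y).
  by move=> [m [n ->]]; exists (k * m), (k * n); rewrite !intrM; ring.
have Ha : H a by exists 1, 0; rewrite mul1r addr0.
have H1 : H 1 by exists 0, 1; rewrite mul0r add0r.
pose E := [set y | 0 < y /\ H y].
have red (y z : R) : 0 < y -> exists k : int, 0 <= z - k%:~R * y < y.
  move=> y0; exists (Num.floor (z / y)).
  have : (Num.floor (z / y))%:~R <= z / y by exact: floor_le.
  have : z / y < (Num.floor (z / y))%:~R + 1 by have := floorD1_gt (z / y); rewrite intrD.
  by rewrite ltr_pdivrMr// ler_pdivlMr//; lra.
suff [y [y0 Hy] ye] : exists2 y, E y & y < e.
  have [k kE] := red y x y0; have [m [n mnE]] := HM y k Hy.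
  by exists m, n; rewrite -mnE ger0_norm; lra.
apply: contrapT => noE.
have Ee y : E y -> e <= y by move=> Ey; rewrite leNgt; apply/negP => ye; apply: noE; exists y.
have E0 : has_inf E by split; [exists 1|exists e].
pose g := inf E.
have ge : e <= g by apply: lb_le_inf => //; case: E0.
have lbg y : E y -> g <= y by move=> Ey; apply: ge_inf => //; case: E0.
have g0 : 0 < g := lt_le_trans e0 ge.
(* Were [g] not attained, two distinct elements of [E] would lie in [[g, 2 g[], and their difference
   would be a positive element below [g]. *)
have Hg : H g.
  have [y [y0 Hy] yg] := inf_adherent g0 E0; rewrite -/g in yg.
  have gy := lbg y (conj y0 Hy).
  have [<-//|yg'] := eqVneq y g.
  have yg0 : 0 < y - g by rewrite subr_gt0 lt_def yg' gy.
  have [z [z0 Hz] zg] := inf_adherent yg0 E0; rewrite -/g in zg.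
  have zy : 0 < y - z by lra.
  by have := lbg _ (conj zy (HB _ _ Hy Hz)); have := lbg z (conj z0 Hz); lra.
have mult (z : R) : H z -> exists k : int, z = k%:~R * g.
  move=> Hz; have [k kE] := red g z g0; exists k; apply/eqP; rewrite -subr_eq0.
  apply/negPn/negP => d0.
  have dE : E (z - k%:~R * g) by split; [lra|exact/HB/HM].
  by have := lbg _ dE; lra.
have [k1 e1] := mult _ H1; have [k2 e2] := mult _ Ha.
apply: irr; exists (k2%:~R / k1%:~R) => //.
have k10 : (k1%:~R : R) != 0.
  by apply/eqP => h; move: e1; rewrite h mul0r => /eqP; rewrite oner_eq0.
rewrite fmorph_div /= !ratr_int.
apply: (mulIf k10); rewrite divfK// e2.
transitivity (k2%:~R * (k1%:~R * g)); first by rewrite -e1 mulr1.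
ring.
Qed.

End NumberTheory.

(** * Convex profiles *)

Section Planar.
Variable R : realType.
Local Notation mu := (@lebesgue_measure R).

(** For the section at [t = 0], which is orthogonal to the axis and hence a ball: its volume
    determines its squared radius [c]. *)
Lemma ball_section (c L : R) : 0 < L ->
  (\int[mu]_z (pi * Num.max 0 (c - z ^+ 2))%:E = (4 / 3 * pi * L ^+ 3)%:E)%E ->
  c = L ^+ 2.
Proof.
move=> L0; pose r := Num.sqrt c.
have r0 : 0 <= r := sqrtr_ge0 c.
have -> : (\int[mu]_z (pi * Num.max 0 (c - z ^+ 2))%:E = (4 / 3 * pi * r ^+ 3)%:E)%E.
  have [c0|c0] := leP c 0.
    rewrite /r ler0_sqrtr// expr0n /= mulr0 integral0_eq// => z _.
    by rewrite max_l ?mulr0//; have := sqr_ge0 z; lra.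
  have rE : r ^+ 2 = c := sqr_sqrtr (ltW c0).
  transitivity (\int[mu]_(z in `[(- r)%R, r]) (pi * c + 0 * z + - pi * z ^+ 2)%:E)%E.
    rewrite [RHS]integral_mkcond; apply: eq_integral => z _; rewrite patchE.
    case: ifPn => [|/negP]; rewrite ?inE /= in_itv /= -ler_norml.
      move=> zr; congr EFin; rewrite max_r; first by ring.
      by rewrite subr_ge0 -rE -(real_normK (num_real z)) ler_sqr ?nnegrE.
    move/negP; rewrite -ltNge => zr; congr EFin; rewrite max_l ?mulr0//.
    by rewrite subr_le0 -rE -(real_normK (num_real z)) ler_sqr ?nnegrE// ltW.
  rewrite integral_quadratic; last lra.
  by congr EFin; rewrite -rE; field.
case=> h; have {}h : r ^+ 3 = L ^+ 3.
  have p0 : 4 / 3 * pi != 0 :> R by rewrite gt_eqF// mulr_gt0// pi_gt0.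
  exact: (mulfI p0).
have rL : r = L.
  by apply/eqP; rewrite -(@eqrXn2 R 3)// ?h// ltW.
rewrite -rL /r sqr_sqrtr// ltW// -sqrtr_gt0 -/r rL//.
Qed.

Variables (q : R -> R) (L : R).
Local Notation K s t := (t ^+ 2 <= q s).
Hypothesis L0 : 0 < L.
Hypothesis Kconv : forall s t s' t' l, K s t -> K s' t' -> 0 <= l <= 1 ->
  K (l * s + (1 - l) * s') (l * t + (1 - l) * t').
Hypothesis Ksym : forall s, q (- s) = q s.
Variable eps : R.
Hypothesis eps0 : 0 < eps.
Hypothesis Kball : forall s t, s ^+ 2 + t ^+ 2 <= (1 + eps) ^+ 2 -> K s t.
Variable M : R.
Hypothesis Kbound : forall s t, K s t -> s ^+ 2 + t ^+ 2 <= M ^+ 2.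
Hypothesis Kclosed : forall s t,
  (forall e, 0 < e -> exists s' t', [/\ `|s - s'| < e, `|t - t'| < e & K s' t']) -> K s t.

Let Kunit s t : s ^+ 2 + t ^+ 2 <= 1 -> K s t.
Proof.
move=> h; apply: Kball; apply: (le_trans h).
by have := sqr_ge0 eps; have := eps0; lra.
Qed.

Let K0 : K 0 0. Proof. by apply: Kunit; rewrite expr0n addr0. Qed.

(** The distances reached inside the profile form a segment starting at 0, by convexity with the
    point of tangency, which lies in the unit disc; [Kclosed] adds the far end. *)
Lemma half_chord (x y : R) : x ^+ 2 + y ^+ 2 = 1 ->
  exists2 a, 0 <= a & forall z, 0 <= z -> K (x - z * y) (y + z * x) = (z <= a).
Proof.
move=> xy1.
pose S := [set z | 0 <= z /\ K (x - z * y) (y + z * x)].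
have S0 : S 0.
  by split => //; rewrite !mul0r subr0 addr0; apply: Kunit; rewrite xy1.
have Sub : ubound S `|M|.
  move=> z [z0 /Kbound h].
  rewrite -[leLHS](ger0_norm z0) -ler_sqr ?nnegrE// !real_normK ?num_real//.
  by apply: le_trans h; nra.
have hS : has_sup S by split; [exists 0|exists `|M|].
exists (sup S); first by apply: ub_le_sup S0; exists `|M|.
have xl : `|x| <= 1 by rewrite -[leRHS]ger0_norm// -ler_sqr ?nnegrE// !real_normK ?num_real//; nra.
have yl : `|y| <= 1 by rewrite -[leRHS]ger0_norm// -ler_sqr ?nnegrE// !real_normK ?num_real//; nra.
move=> z z0; apply/idP/idP => [Kz|zS].
  by apply: ub_le_sup; [by exists (`|M|)|split].
apply: Kclosed => e e0.
have [z' [z'0 Kz'] lt] := sup_adherent e0 hS.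
have [zz'|z'z] := leP z z'.
  exists (x - z * y), (y + z * x); rewrite !subrr normr0; split => //.
  have [z'1|z'1] := eqVneq z' 0.
    have -> : z = 0 by lra.
    by have [] := S0.
  have z'p : 0 < z' by lra.
  have -> : x - z * y = z / z' * (x - z' * y) + (1 - z / z') * x by field.
  have -> : y + z * x = z / z' * (y + z' * x) + (1 - z / z') * y by field.
  apply: Kconv => //; first by apply: Kunit; rewrite xy1.
  by rewrite divr_ge0// ler_pdivrMr// mul1r.
exists (x - z' * y), (y + z' * x); split => //.
  have -> : x - z * y - (x - z' * y) = (z' - z) * y by ring.
  rewrite normrM; apply: le_lt_trans (ler_piMr _ yl) _ => //.
  by rewrite ltr0_norm; lra.
have -> : y + z * x - (y + z' * x) = (z - z') * x by ring.
rewrite normrM; apply: le_lt_trans (ler_piMr _ xl) _ => //.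
by rewrite gtr0_norm; lra.
Qed.

(** The backward half is the forward half at angle [- t], as the profile is symmetric about the
    axis. *)
Lemma chord (t : R) : exists a b, [/\ 0 <= a, 0 <= b & forall z,
  ((sin t + z * cos t) ^+ 2 <= q (cos t - z * sin t)) = (- b <= z <= a)].
Proof.
have [a a0 ha] := half_chord (cos2Dsin2 t).
have c2 : cos (- t) ^+ 2 + sin (- t) ^+ 2 = 1 := cos2Dsin2 (- t).
have [b b0 hb] := half_chord c2; rewrite cosN sinN in hb.
exists a, b; split => // z.
have [z0|z0] := leP 0 z.
  by rewrite ha//; case: (leP z a) => _; rewrite ?andbF// andbT; lra.
have := hb (- z); rewrite oppr_ge0 (ltW z0) => /(_ isT).
have -> : cos t - - z * - sin t = cos t - z * sin t by ring.
have -> : (- sin t + - z * cos t) ^+ 2 = (sin t + z * cos t) ^+ 2 by ring.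
move=> ->; rewrite lerNl.
by case: (leP (- b) z) => _ //=; lra.
Qed.

Let r := Num.sqrt (1 + L ^+ 2).
Let psi := atan L.

(** Radial form of lying on the boundary, available because the origin is interior; convex
    combinations contradict it by producing a dilate. *)
Definition on_circle (p : R) : Prop :=
  K (r * cos p) (r * sin p) /\ forall m, 1 < m -> ~ K (m * (r * cos p)) (m * (r * sin p)).

Lemma on_circleN p : on_circle p -> on_circle (- p).
Proof.
by rewrite /on_circle cosN sinN !mulrN sqrrN => -[h1 h2]; split => // m /h2; rewrite mulrN sqrrN.
Qed.

Lemma on_circleDpi p : on_circle p -> on_circle (p + pi).
Proof.
rewrite /on_circle cosDpi sinDpi !mulrN sqrrN Ksym => -[h1 h2]; split => // m /h2.
by rewrite !mulrN sqrrN Ksym.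
Qed.

Lemma on_circleDint p (j : int) : on_circle p -> on_circle (p + j%:~R * pi).
Proof.
have nat_case (n : nat) x : on_circle x -> on_circle (x + n%:R * pi).
  elim: n x => [|n IH] x gx; first by rewrite mul0r addr0.
  rewrite -natr1 mulrDl mul1r addrA; exact/on_circleDpi/IH.
case: j => n; first exact: nat_case.
move=> /on_circleN/(nat_case n.+1)/on_circleN; rewrite opprD opprK.
by rewrite NegzE mulrNz mulNr.
Qed.

Let r0 : 0 < r. Proof. by rewrite sqrtr_gt0; nra. Qed.
Let r2 : r ^+ 2 = 1 + L ^+ 2. Proof. by rewrite sqr_sqrtr//; nra. Qed.
Let r1 : 1 <= r.
Proof.
rewrite leNgt; apply/negP => h; have := r0; have := r2; have := sqr_ge0 L; nra.
Qed.

Let cpsi : r * cos psi = 1.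
Proof. by rewrite /psi cos_atan -/r mulfV// gt_eqF. Qed.

Let spsi : r * sin psi = L.
Proof.
have cp : cos psi != 0.
  by apply/eqP => h; have := cpsi; rewrite h mulr0 => /eqP; rewrite eq_sym oner_eq0.
have := atanK L; rewrite -/psi /tan => h.
by rewrite -[RHS]mul1r -cpsi -h -mulrA [cos _ * _]mulrC divfK.
Qed.

(** As [r cos psi = 1] and [r sin psi = L], the circle point at angle [t + psi] is the point of the
    tangent line at distance [L]. Write [n] for the point of tangency and [P] for this circle
    point. *)
Lemma on_circle_chord t a b : 0 <= a -> 0 <= b ->
  (forall z, ((sin t + z * cos t) ^+ 2 <= q (cos t - z * sin t)) = (- b <= z <= a)) ->
  on_circle (t + psi) <-> a = L.
Proof.
move=> a0 b0 hz.
have cE : r * cos (t + psi) = cos t - L * sin t.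
  rewrite cosD; transitivity (r * cos psi * cos t - r * sin psi * sin t); first by ring.
  by rewrite cpsi spsi mul1r.
have sE : r * sin (t + psi) = sin t + L * cos t.
  rewrite sinD; transitivity (r * cos psi * sin t + r * sin psi * cos t); first by ring.
  by rewrite cpsi spsi mul1r.
have cs := cos2Dsin2 t.
rewrite /on_circle cE sE; split => [[h1 h2]|aL].
  have La : L <= a by move: h1; rewrite hz => /andP[].
  apply/eqP; rewrite eq_le La andbT leNgt; apply/negP => aL.
  pose l := L / a; have ap : 0 < a := lt_trans L0 aL.
  have lE : l * a = L by rewrite /l divfK// gt_eqF.
  have l1 : 0 < l < 1 by rewrite divr_gt0// ltr_pdivrMr// mul1r.
  (* If [a > L], mixing the far end of the chord with [n + k P] gives [(1 + (1 - l) k) P], a dilate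
     of [P]; the choice of [k] keeps [n + k P] in the disc of radius [1 + eps]. *)
  pose k := eps / r; have k0 : 0 < k by rewrite divr_gt0.
  have kE : k * r = eps by rewrite /k divfK// gt_eqF.
  apply: (h2 (1 + (1 - l) * k)); first by nra.
  have Ka : K (cos t - a * sin t) (sin t + a * cos t) by rewrite hz lexx andbT; have := L0; lra.
  have Kb : K ((1 + k) * cos t - k * L * sin t) ((1 + k) * sin t + k * L * cos t).
    apply: Kball.
    have -> : ((1 + k) * cos t - k * L * sin t) ^+ 2 + ((1 + k) * sin t + k * L * cos t) ^+ 2 =
      (1 + 2 * k + k ^+ 2 * (1 + L ^+ 2)) * (cos t ^+ 2 + sin t ^+ 2) by ring.
    rewrite cs mulr1 -r2 -exprMn kE.
    have : k <= eps by rewrite -kE ler_peMr// ltW.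
    by have := eps0; nra.
  have l01 : 0 <= l <= 1 by lra.
  have := Kconv Ka Kb l01.
  have -> : l * (cos t - a * sin t) + (1 - l) * ((1 + k) * cos t - k * L * sin t) =
     (1 + (1 - l) * k) * (cos t - L * sin t) by rewrite -lE; ring.
  by have -> : l * (sin t + a * cos t) + (1 - l) * ((1 + k) * sin t + k * L * cos t) =
     (1 + (1 - l) * k) * (sin t + L * cos t) by rewrite -lE; ring.
split; first by rewrite hz aL lexx andbT; have := L0; lra.
move=> m m1 Km.
have m0 : 0 < m by lra.
have mi : 0 < m^-1 < 1 by rewrite invr_gt0 m0 invf_lt1.
(* The unit vector along the tangent line. Mixed with [m P] in proportion [1 / m], it gives a point
   of the tangent line at distance [L + (1 - 1 / m)], beyond the end of the chord. *)
have Kw : K (- sin t) (cos t) by apply: Kunit; lra.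
have mi' : 0 <= m^-1 <= 1 by lra.
have := Kconv Km Kw mi'.
rewrite !mulrA mulVf ?gt_eqF// !mul1r.
have -> : cos t - L * sin t + (1 - m^-1) * - sin t = cos t - (L + (1 - m^-1)) * sin t by ring.
have -> : sin t + L * cos t + (1 - m^-1) * cos t = sin t + (L + (1 - m^-1)) * cos t by ring.
by rewrite hz aL => /andP[_]; lra.
Qed.

Lemma on_circle_chordN t a b : 0 <= a -> 0 <= b ->
  (forall z, ((sin t + z * cos t) ^+ 2 <= q (cos t - z * sin t)) = (- b <= z <= a)) ->
  on_circle (t - psi) <-> b = L.
Proof.
move=> a0 b0 hz.
have hz' z : ((sin (- t) + z * cos (- t)) ^+ 2 <= q (cos (- t) - z * sin (- t))) = (- a <= z <= b).
  have := hz (- z); rewrite cosN sinN.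
  have -> : cos t - - z * sin t = cos t - z * - sin t by ring.
  have -> : (sin t + - z * cos t) ^+ 2 = (- sin t + z * cos t) ^+ 2 by ring.
  by move=> ->; rewrite lerN2 lerNl andbC.
have <- := on_circle_chord b0 a0 hz'.
by split => /on_circleN; rewrite opprD ?opprK addrC.
Qed.

Hypothesis mq : measurable_fun setT q.
Hypothesis sec : forall t : R, (\int[mu]_z (pi * Num.max 0
  (q (cos t - z * sin t) - (sin t + z * cos t) ^+ 2))%:E = (4 / 3 * pi * L ^+ 3)%:E)%E.

Lemma on_circle_psi : on_circle psi.
Proof.
have [a [b [a0 b0 hz]]] := chord 0.
rewrite -[psi]add0r; apply/(on_circle_chord a0 b0 hz).
have qL : q 1 = L ^+ 2.
  apply: ball_section L0 _; rewrite -(sec 0); apply: eq_integral => z _.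
  by rewrite sin0 cos0 !mulr0 subr0 mulr1 add0r.
have {}hz z : (z ^+ 2 <= L ^+ 2) = (- b <= z <= a).
  by rewrite -hz sin0 cos0 !mulr0 subr0 mulr1 add0r qL.
have La : L <= a by have := hz L; rewrite lexx => /esym /andP[].
have aL : a ^+ 2 <= L ^+ 2 by rewrite hz lexx andbT; lra.
by apply/eqP; rewrite eq_le La andbT; have := L0; nra.
Qed.

(** The constant section volume is that of a 3-ball of radius [L], so [a = b = L] solves the chord
    equation at every angle. *)
Lemma chord_lengths t a b : 0 < t < pi -> 0 <= a -> 0 <= b ->
  (forall z, ((sin t + z * cos t) ^+ 2 <= q (cos t - z * sin t)) = (- b <= z <= a)) ->
  2 * cos t * (a ^+ 3 + b ^+ 3 - 2 * L ^+ 3) + 3 * sin t * (a ^+ 2 - b ^+ 2) = 0.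
Proof.
move=> tp a0 b0 hz; have ab : - b <= a by lra.
have := chord_identity mq sec tp ab hz.
move=> h; have : pi * (2 * cos t * (a ^+ 3 + b ^+ 3 - 2 * L ^+ 3) + 3 * sin t * (a ^+ 2 - b ^+ 2)) = 0.
  by lra.
by move/eqP; rewrite mulf_eq0 gt_eqF ?pi_gt0//= => /eqP.
Qed.

Let pihalf_lt_pi (t : R) : 0 < t < pi / 2 -> 0 < t < pi.
Proof. by have := pi_gt0 R => p0 /andP[-> /=]; lra. Qed.

(** With [b = L] the factor [a - L] splits off, and its cofactor is a sum of a non-negative and a
    positive term. *)
Lemma on_circle_fwd t : 0 < t < pi / 2 -> on_circle (t - psi) -> on_circle (t + psi).
Proof.
move=> tp; have [a [b [a0 b0 hz]]] := chord t.
move/(on_circle_chordN a0 b0 hz) => bL; apply/(on_circle_chord a0 b0 hz).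
have := chord_lengths (pihalf_lt_pi tp) a0 b0 hz; rewrite bL => h.
have st : 0 < sin t by exact: sin_gt0_pihalf.
have ct : 0 < cos t by apply: cos_gt0_pihalf; lra.
have : (a - L) * (2 * cos t * (a ^+ 2 + a * L + L ^+ 2) + 3 * sin t * (a + L)) = 0 by lra.
move/eqP; rewrite mulf_eq0 subr_eq0 => /orP[/eqP//|/eqP h0].
have := L0 => L0'; have : 0 < 3 * sin t * (a + L) by rewrite !mulr_gt0//; lra.
have : 0 <= 2 * cos t * (a ^+ 2 + a * L + L ^+ 2).
  apply: mulr_ge0; first lra.
  by have := mulr_ge0 a0 (ltW L0'); have := sqr_ge0 a; have := sqr_ge0 L; lra.
lra.
Qed.

(** The bound is where the line through the circle points at [al] and [be] meets the axis. From an
    axis point farther out, the segment to the point at [be] would cross the ray at [al] outside the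
    circle. *)
Lemma axis_outer x al be : 0 < x -> K x 0 -> on_circle al -> on_circle be ->
  0 < al -> al < be -> be < pi / 2 ->
  x <= r * (sin (al - be) / (sin al - sin be)).
Proof.
move=> x0 Kx [_ ha] [hb _] al0 ab bp; have p0 := pi_gt0 R.
have sa : 0 < sin al by apply: sin_gt0_pihalf; lra.
have sab : sin al < sin be by rewrite ltr_sin// in_itv /=; lra.
have S0 : 0 < sin (be - al) by apply: sin_gt0_pihalf; lra.
rewrite -opprB sinN -[sin al - _]opprB invrN mulrNN leNgt; apply/negP => xx0.
have D0 : 0 < sin be - sin al by rewrite subr_gt0.
move: xx0; rewrite mulrA ltr_pdivrMr// => hx.
(* The weight [l] puts the combination on the ray at [al]; the dilation factor is then
   [x sin be / w], which exceeds 1 exactly by [hx]. *)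
pose w := x * sin al + r * sin (be - al).
have w0 : 0 < w by rewrite addr_gt0// mulr_gt0.
pose l := r * sin (be - al) / w.
have l01 : 0 <= l <= 1.
  apply/andP; split; first by apply: divr_ge0 (ltW w0); apply: mulr_ge0; exact: ltW.
  by rewrite /l ler_pdivrMr// mul1r /w lerDr; apply: mulr_ge0; exact: ltW.
have := Kconv Kx hb l01.
have -> : l * 0 + (1 - l) * (r * sin be) = x * sin be / w * (r * sin al).
  by rewrite /l /w; field; rewrite -/w gt_eqF.
have -> : l * x + (1 - l) * (r * cos be) = x * sin be / w * (r * cos al).
  have wE := sinB be al; rewrite /l.
  apply: (mulIf (lt0r_neq0 w0)).
  transitivity (r * sin (be - al) * x + (w - r * sin (be - al)) * (r * cos be)).
    by field; rewrite gt_eqF.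
  by rewrite /w addrK wE; field; rewrite -wE -/w gt_eqF.
apply: ha; rewrite ltr_pdivlMr// mul1r /w.
by rewrite -ltrBrDl -mulrBr.
Qed.

Lemma axis_inner al : on_circle al -> K (r * cos al) 0.
Proof.
move=> ga; have [ha _] := ga; have [hN _] := on_circleN ga.
have h : 0 <= (2^-1 : R) <= 1 by lra.
have := Kconv ha hN h; rewrite cosN sinN.
have -> : 2^-1 * (r * cos al) + (1 - 2^-1) * (r * cos al) = r * cos al by field.
by have -> : 2^-1 * (r * sin al) + (1 - 2^-1) * (r * - sin al) = 0 by field.
Qed.

(** The tangent line crosses the axis at [z = - tan t], in the point of axis coordinate
    [1 / cos t]. *)
Lemma axis_chord t a b : 0 < t < pi / 2 -> 0 <= a ->
  (forall z, ((sin t + z * cos t) ^+ 2 <= q (cos t - z * sin t)) = (- b <= z <= a)) ->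
  (K (cos t)^-1 0) = (tan t <= b).
Proof.
move=> tp a0 hz.
have st : 0 < sin t by exact: sin_gt0_pihalf.
have ct : 0 < cos t by apply: cos_gt0_pihalf; lra.
have t0 : 0 < tan t by rewrite divr_gt0.
have := hz (- tan t).
have -> : sin t + - tan t * cos t = 0 by rewrite mulNr divfK ?subrr// gt_eqF.
have -> : cos t - - tan t * sin t = (cos t)^-1.
  rewrite /tan; transitivity ((cos t ^+ 2 + sin t ^+ 2) / cos t); last by rewrite cos2Dsin2 mul1r.
  by field; rewrite gt_eqF.
move=> ->; rewrite lerN2.
have -> : - tan t <= a by lra.
by rewrite andbT.
Qed.

(** So [atan (sqrt (x ^ 2 - 1))], the form in which axis points enter [G], is at [x = 1 / cos t] the
    angle [t] of the tangent line through that point. *)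
Lemma tan_sqr (t : R) : 0 < t < pi / 2 -> tan t ^+ 2 = (cos t)^-1 ^+ 2 - 1.
Proof.
move=> tp; have ct : 0 < cos t by apply: cos_gt0_pihalf; lra.
by rewrite exprVn cos2_tan2 ?gt_eqF//; ring.
Qed.

Let tan_gt0 (t : R) : 0 < t < pi / 2 -> 0 < tan t.
Proof.
by move=> tp; rewrite divr_gt0 ?sin_gt0_pihalf//; apply: cos_gt0_pihalf; lra.
Qed.

Let atan_tan (t : R) : 0 < t < pi / 2 -> atan (tan t) = t.
Proof. by move=> tp; apply: tanK; rewrite in_itv /=; lra. Qed.

(* Besides [b = L], the chord equation has the root given by
   [3 tan t (b + L) = 2 (b^2 + b L + L^2)]; it ends on the other side of the axis. *)
Lemma on_circle_bwd t : 0 < t < pi / 2 -> on_circle (t + psi) ->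
  3 * tan t < 2 * L \/
  (exists al be, [/\ on_circle al, on_circle be, 0 < al, al < be & be < pi / 2] /\
   atan (Num.sqrt ((r * (sin (al - be) / (sin al - sin be))) ^+ 2 - 1)) - psi < `|t - psi| /\
   psi - atan (Num.sqrt ((r * cos al) ^+ 2 - 1)) < `|t - psi|) ->
  on_circle (t - psi).
Proof.
move=> tp; have [a [b [a0 b0 hz]]] := chord t.
move/(on_circle_chord a0 b0 hz) => aL cond; apply/(on_circle_chordN a0 b0 hz).
have st : 0 < sin t by exact: sin_gt0_pihalf.
have ct : 0 < cos t by apply: cos_gt0_pihalf; lra.
have T0 := tan_gt0 tp; have tT := atan_tan tp; have T2 := tan_sqr tp.
have axis := axis_chord tp a0 hz.
have := chord_lengths (pihalf_lt_pi tp) a0 b0 hz; rewrite aL.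
have -> : sin t = tan t * cos t by rewrite divfK// gt_eqF.
move=> h; have {h} : cos t * (2 * (b ^+ 3 - L ^+ 3) + 3 * tan t * (L ^+ 2 - b ^+ 2)) = 0 by lra.
move/eqP; rewrite mulf_eq0 gt_eqF//= => /eqP h.
have {h} : (b - L) * (2 * (b ^+ 2 + b * L + L ^+ 2) - 3 * tan t * (b + L)) = 0 by lra.
move/eqP; rewrite mulf_eq0 subr_eq0 => /orP[/eqP//|/eqP h].
set T := tan t in T0 tT T2 h axis cond *.
have TE : T = Num.sqrt (T ^+ 2) by rewrite sqrtr_sqr gtr0_norm.
have Lp := L0.
(* Under the first condition, [2 (b^2 + b L + L^2) >= 2 L (b + L) > 3 tan t (b + L)]. *)
case: cond => [TL|[al [be [[ga gb al0 ab bp] [Fp Fm]]]]].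
  have : (2 * L - 3 * T) * (b + L) > 0 by rewrite mulr_gt0//; lra.
  by have := sqr_ge0 b; nra.
(* The bound by [|t - psi|] places [1 / cos t] beyond the outer axis bound if [t >= psi], and within
   the inner one otherwise. Either way [b] and [L] are on the same side of [tan t], where the
   remaining equation forces [b = L]. *)
have [pt|tps] := leP psi t.
- have LT : L <= T.
    by rewrite leNgt; apply/negP => /lt_atan; rewrite tT -/psi; lra.
  have bT : b <= T.
    rewrite leNgt; apply/negP => Tb.
    have Kx : K (cos t)^-1 0 by rewrite axis ltW.
    have ci : 0 < (cos t)^-1 by rewrite invr_gt0.
    have hx := axis_outer ci Kx ga gb al0 ab bp.
    have : T <= Num.sqrt ((r * (sin (al - be) / (sin al - sin be))) ^+ 2 - 1).
      rewrite TE; apply: ler_wsqrtr; rewrite T2 lerD2r.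
      apply: lerXn2r; rewrite ?nnegrE; [exact: ltW|exact: le_trans (ltW ci) hx|exact: hx].
    move/le_atan; rewrite tT; move: Fp; rewrite ger0_norm; lra.
  by nra.
- have TL : T <= L.
    by rewrite leNgt; apply/negP => /lt_atan; rewrite tT -/psi; lra.
  have Tb : T <= b.
    rewrite leNgt; apply/negP => bT.
    have ca : 0 < r * cos al by rewrite mulr_gt0//; apply: cos_gt0_pihalf; lra.
    have hx : r * cos al < (cos t)^-1.
      rewrite ltNge; apply/negP => hle.
      suff : K (cos t)^-1 0 by rewrite axis; lra.
      pose l := (cos t)^-1 / (r * cos al).
      have l01 : 0 <= l <= 1.
        apply/andP; split; first by apply: divr_ge0 (ltW ca); rewrite invr_ge0 ltW.
        by rewrite /l ler_pdivrMr// mul1r.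
      have := Kconv (axis_inner ga) K0 l01.
      rewrite !mulr0 !addr0 /l divfK// gt_eqF//.
    have : Num.sqrt ((r * cos al) ^+ 2 - 1) <= T.
      rewrite TE; apply: ler_wsqrtr; rewrite T2 lerD2r.
      apply: lerXn2r; rewrite ?nnegrE; [exact: ltW|by rewrite invr_ge0 ltW|exact: ltW].
    move/le_atan; rewrite tT; move: Fm; rewrite ltr0_norm; lra.
  by nra.
Qed.

Lemma on_circle_oppDint p p' (j : int) : p' = - p + j%:~R * pi -> on_circle p -> on_circle p'.
Proof. by move=> -> /on_circleN; exact: on_circleDint. Qed.

(** * The odd multiples of [psi] and their density *)

Section Orbit.
Variable A : R.
Hypothesis RAr : RA A = r.
Hypothesis psi_gamma : psi = gamma A * pi.
Hypothesis L2 : 2 < L.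
Hypothesis irr : irrational (gamma A).
Hypothesis HC : forall k : nat, (2 <= k)%N -> condC A k.

Let gamma_neq (m : nat) (j : int) : (0 < m)%N -> m%:R * gamma A != j%:~R.
Proof.
move=> m0; apply/eqP => h; apply: irr; apply/rationalP; exists j, m.
by rewrite -h mulrAC mulfV ?mul1r// pnatr_eq0 -lt0n.
Qed.

Let psi_bounds : pi / 4 < psi < pi / 2.
Proof. by rewrite atan_ltpi2 -atan1 lt_atan//; have := L2; lra. Qed.

Let gamma_bounds : 4^-1 < gamma A < 2^-1.
Proof.
have p0 := pi_gt0 R; have := psi_bounds; rewrite psi_gamma => h.
by apply/andP; split; rewrite -(ltr_pM2r p0); lra.
Qed.

(** Both bounds are strict because an odd multiple of [psi] at distance 0 or [pi / 2] from the
    multiples of [pi] would make [gamma A] rational. *)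
Lemma deltaP (i : nat) : (1 <= i)%N -> exists j : int,
  [/\ delta A i = `|(2 * i%:R - 1) * psi - j%:~R * pi|,
   (forall j' : int, delta A i <= `|(2 * i%:R - 1) * psi - j'%:~R * pi|) &
   0 < delta A i < pi / 2].
Proof.
move=> i1; have p0 := pi_gt0 R.
have [j [jE jmin j2]] := inf_dist_int ((2 * i%:R - 1) * gamma A).
have scale (j' : int) : `|(2 * i%:R - 1) * psi - j'%:~R * pi| =
    pi * `|(2 * i%:R - 1) * gamma A - j'%:~R|.
  rewrite psi_gamma mulrA -mulrBl normrM mulrC; congr (_ * _).
  by rewrite ger0_norm// ltW.
exists j; rewrite /delta jE scale; split => //.
  by move=> j'; rewrite scale ler_pM2l.
have iE := natr_odd R i1; have i2E := natr_odd2 R i1; have [m1 m0] := odd_pos i1.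
apply/andP; split.
  by rewrite mulr_gt0// normr_gt0 subr_eq0 iE; exact: gamma_neq.
rewrite ltr_pM2l// lt_neqAle j2 andbT.
apply/eqP => h.
have [e|e] : (2 * i%:R - 1) * 2 * gamma A = (2 * j + 1)%:~R \/
    (2 * i%:R - 1) * 2 * gamma A = (2 * j - 1)%:~R.
- rewrite intrD intrB !intrM; case: (ger0P ((2 * i%:R - 1) * gamma A - j%:~R)) h => _ h.
    by left; lra.
  by right; lra.
- by move: e; rewrite i2E => /eqP; rewrite (negbTE (gamma_neq _ m0)).
- by move: e; rewrite i2E => /eqP; rewrite (negbTE (gamma_neq _ m0)).
Qed.

(** Ensures that [beta] is an infimum over a non-empty set for all [k >= 2]; equality would make
    [2 gamma] or [4 gamma] an integer. *)
Lemma delta_inj1 : delta A 1 <> delta A 2.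
Proof.
have [j [-> _ _]] := deltaP (leqnn 1); have [j' [-> _ _]] := deltaP (isT : (1 <= 2)%N).
have p0 := pi_gt0 R.
have -> : (2 * 1%:R - 1) * psi = psi by ring.
have -> : (2 * 2%:R - 1) * psi = 3 * psi by ring.
move=> h.
have [e|e] : 2%:R * gamma A = (j' - j)%:~R \/ 4%:R * gamma A = (j + j')%:~R.
- have : psi - j%:~R * pi = 3 * psi - j'%:~R * pi \/ psi - j%:~R * pi = - (3 * psi - j'%:~R * pi).
    case: (ger0P (psi - j%:~R * pi)) h => _; case: (ger0P (3 * psi - j'%:~R * pi)) => _ h.
    + by left.
    + by right.
    + by right; lra.
    + by left; lra.
  rewrite psi_gamma => -[e|e]; [left|right]; apply: (mulIf (lt0r_neq0 p0));
    rewrite ?intrB ?intrD; lra.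
- by move/eqP: e; rewrite (negbTE (gamma_neq _ _)).
- by move/eqP: e; rewrite (negbTE (gamma_neq _ _)).
Qed.

Lemma alpha_beta (k : nat) : (2 <= k)%N ->
  (forall i, (1 <= i <= k)%N -> on_circle (delta A i)) ->
  [/\ on_circle (alpha A k), on_circle (beta A k), 0 < alpha A k,
   alpha A k < beta A k & beta A k < pi / 2].
Proof.
move=> k2 gk.
have [i [ik aE amin]] : exists i, [/\ (1 <= i <= k)%N, alpha A k = delta A i &
    forall j, (1 <= j <= k)%N -> delta A i <= delta A j].
  apply: (@inf_finite_image R (delta A) [set i | (1 <= i <= k)%N] k).
    by move=> i /andP[].
  by exists 1%N; rewrite /= ltnW.
have [i' [[i'k i'a] bE bmin]] : exists i', [/\ (1 <= i' <= k)%N /\ delta A i' <> alpha A k,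
    beta A k = delta A i' &
    forall j, (1 <= j <= k)%N /\ delta A j <> alpha A k -> delta A i' <= delta A j].
  have -> : beta A k = inf (delta A @` [set i | (1 <= i <= k)%N /\ delta A i <> alpha A k]).
    congr inf; apply/seteqP; split => [_ [[j jk <-] ja]|_ [j [jk ja] <-]].
      by exists j.
    by split => //; exists j.
  apply: (@inf_finite_image R (delta A) [set i | (1 <= i <= k)%N /\ delta A i <> alpha A k] k).
    by move=> j [/andP[]].
  have [e|e] := pselect (delta A 1 = alpha A k).
    by exists 2%N; split => //=; rewrite -e => /esym; exact: delta_inj1.
  by exists 1%N; split => //=; rewrite ltnW.
have i1 : (1 <= i)%N by case/andP: ik.
have i'1 : (1 <= i')%N by case/andP: i'k.
have [_ [_ _ /andP[d0 _]]] := deltaP i1.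
have [_ [_ _ /andP[_ d1]]] := deltaP i'1.
rewrite bE aE; split => //; [exact: gk|exact: gk|].
rewrite lt_neqAle amin// andbT; apply/eqP => e; apply: i'a.
by rewrite aE -e.
Qed.

(** The induction is strong because a step that meets the spurious root uses all earlier circle
    points, through [alpha] and [beta]. *)
Lemma on_circle_odd (k : nat) : on_circle ((2 * k%:R + 1) * psi).
Proof.
have p0 := pi_gt0 R; have pb := psi_bounds.
elim/ltn_ind: k => -[_|k IH]; first by rewrite mulr0 add0r mul1r; exact: on_circle_psi.
have IHk := IH k (ltnSn k).
(* Subtracting the nearest multiple of [pi] folds [2 (k + 1) psi] between [- pi / 2] and [pi / 2].
   Its absolute value is the angle of a tangent line joining the known multiple to the next, and its
   sign decides the direction. *)
have [j [_ _ j2]] := inf_dist_int (2 * k.+1%:R * gamma A).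
have xj0 : 2 * k.+1%:R * gamma A != j%:~R.
  by rewrite -natrM; exact: gamma_neq.
have xj1 : `|2 * k.+1%:R * gamma A - j%:~R| < 2^-1.
  rewrite lt_neqAle j2 andbT; apply/eqP => h.
  have [e|e] : (4 * k.+1)%:R * gamma A = (2 * j + 1)%:~R \/
      (4 * k.+1)%:R * gamma A = (2 * j - 1)%:~R.
  - rewrite intrD intrB !intrM natrM; case: (ger0P (2 * k.+1%:R * gamma A - j%:~R)) h => _ h.
      by left; lra.
    by right; lra.
  - by move/eqP: e; rewrite (negbTE (gamma_neq _ _)).
  - by move/eqP: e; rewrite (negbTE (gamma_neq _ _)).
pose t := `|2 * k.+1%:R * psi - j%:~R * pi|.
have tE : t = pi * `|2 * k.+1%:R * gamma A - j%:~R|.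
  rewrite /t psi_gamma mulrA -mulrBl normrM mulrC; congr (_ * _).
  by rewrite ger0_norm// ltW.
have tp : 0 < t < pi / 2.
  by rewrite tE ltr_pM2l// xj1 andbT mulr_gt0// normr_gt0 subr_eq0.
have kS : k.+1%:R = k%:R + 1 :> R by rewrite natr1.
move: tE; rewrite /t in tp *; case: (ger0P (2 * k.+1%:R * psi - j%:~R * pi)) tp => sgn tp tE.
  have h : on_circle (2 * k.+1%:R * psi - j%:~R * pi - psi).
    have -> : 2 * k.+1%:R * psi - j%:~R * pi - psi = (2 * k%:R + 1) * psi + (- j)%:~R * pi.
      by rewrite kS mulrNz; ring.
    exact: on_circleDint.
  have := on_circleDint j (on_circle_fwd tp h).
  by have -> : 2 * k.+1%:R * psi - j%:~R * pi + psi + j%:~R * pi = (2 * k.+1%:R + 1) * psi by ring.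
(* The folded angle is negative: after reflection in the axis, the known multiple sits at [u + psi]
   and the wanted one at [u - psi]. *)
set u := - _ in tp tE.
have h : on_circle (u + psi).
  apply: (@on_circle_oppDint ((2 * k%:R + 1) * psi) _ j) => //.
  by rewrite /u kS; ring.
have uE : `|u - psi| = `|(2 * k.+2%:R - 1) * psi - j%:~R * pi|.
  rewrite -normrN; congr (`|_|); rewrite /u -[k.+2%:R]natr1; ring.
suff : on_circle (u - psi).
  by apply: (@on_circle_oppDint _ _ j); rewrite /u; ring.
apply: (on_circle_bwd tp h); clear h.
(* In the first step [gamma] is between 1/4 and 1/2, so [j = 1] and [tan u = 2 L / (L^2 - 1)]; then
   [3 tan u < 2 L] amounts to [L > 2]. *)
case: k => [|k] in IH IHk j2 xj0 xj1 t kS sgn u tp tE uE *.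
  left; have gb := gamma_bounds.
  have jE : j = 1.
    move: xj1; rewrite mulr1n ltr_norml => /andP[h1 h2].
    by apply: (@int_eq1 R); lra.
  have uE' : u = pi - 2 * psi by rewrite /u jE mulr1n mulr1z; ring.
  have -> : tan u = - tan (2 * psi).
    by rewrite uE' addrC tanDpi tanN.
  have cp : cos psi != 0 by apply: lt0r_neq0; apply: cos_gt0_pihalf; lra.
  have -> : 2 * psi = psi *+ 2 by rewrite mulr_natl.
  rewrite tan_mulr2n// atanK.
  have Lb := L2; have D : 0 < L ^+ 2 - 1 by nra.
  have -> : - (L *+ 2 / (1 - L ^+ 2)) = 2 * L / (L ^+ 2 - 1).
    by rewrite -[1 - _]opprB invrN mulrN opprK -[L *+ 2]mulr_natl.
  rewrite mulrA ltr_pdivrMr//; nra.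
(* The wanted multiple is [(2 (k + 3) - 1) psi], so [|u - psi|] is at least [delta A k.+3], the
   bound in [condC A k.+2]. The known multiples are, up to sign and multiples of [pi], the
   [delta A i] with [1 <= i <= k + 2]. *)
right; exists (alpha A k.+2), (beta A k.+2).
have ab := @alpha_beta k.+2 isT.
split.
  apply: ab => i /andP[i1 ik].
  have [j' [dE _ _]] := deltaP i1.
  have gi : on_circle ((2 * i%:R - 1) * psi).
    case: i i1 ik {dE} => // i _ ik.
    have -> : 2 * i.+1%:R - 1 = 2 * i%:R + 1 :> R by rewrite -natr1; ring.
    exact: IH.
  rewrite dE; case: (ger0P ((2 * i%:R - 1) * psi - j'%:~R * pi)) => _.
    have -> : (2 * i%:R - 1) * psi - j'%:~R * pi = (2 * i%:R - 1) * psi + (- j')%:~R * pi.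
      by rewrite mulrNz; ring.
    exact: on_circleDint.
  by apply: (@on_circle_oppDint _ _ j') gi; ring.
have [F1 F2] := HC (isT : (2 <= k.+2)%N).
have [_ [_ dmin _]] := deltaP (isT : (1 <= k.+3)%N).
have psiE : atan (Num.sqrt (RA A ^+ 2 - 1)) = psi.
  rewrite RAr r2 addrC addKr sqrtr_sqr ger0_norm//; have := L0; lra.
split.
  rewrite uE; apply: lt_le_trans (dmin j); move: F1.
  by rewrite /Fplus /G psiE RAr.
rewrite uE; apply: lt_le_trans (dmin j); move: F2.
by rewrite /Fminus /G psiE RAr opprB.
Qed.

Lemma on_circle_int (m : int) : on_circle ((2 * m%:~R + 1) * psi).
Proof.
case: m => n; first exact: on_circle_odd.
apply: (@on_circle_oppDint ((2 * n%:R + 1) * psi) _ 0); last exact: on_circle_odd.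
by rewrite NegzE mulrNz -pmulrn -natr1; ring.
Qed.

(** Divided by [pi], the angles [(2 m + 1) psi + n pi] form the translate by [gamma A] of the group
    generated by [2 gamma A] and [1]. *)
Lemma on_circle_dense (p e : R) : 0 < e -> exists2 p', on_circle p' & `|p - p'| < e.
Proof.
move=> e0; have p0 := pi_gt0 R.
have irr2 : irrational (2 * gamma A).
  move=> /rationalP [a [b h]]; apply: irr; apply/rationalP; exists a, (b * 2)%N.
  by rewrite natrM invfM mulrA -h; field.
have e1 : 0 < e / pi by rewrite divr_gt0.
have [m [n mn]] := irrational_int_dense irr2 (p / pi - gamma A) e1.
exists ((2 * m%:~R + 1) * psi + n%:~R * pi); first exact/on_circleDint/on_circle_int.
rewrite psi_gamma.
have -> : p - ((2 * m%:~R + 1) * (gamma A * pi) + n%:~R * pi) =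
    (p / pi - gamma A - (m%:~R * (2 * gamma A) + n%:~R)) * pi.
  by rewrite mulrBl mulrBl divfK ?gt_eqF//; ring.
by rewrite normrM (gtr0_norm p0) -ltr_pdivlMr.
Qed.

Lemma on_circle_near (p e : R) : 0 < e -> exists p',
  [/\ on_circle p', `|cos p - cos p'| < e & `|sin p - sin p'| < e].
Proof.
move=> e0.
have /cvgrPdist_lt/(_ e e0)/nbhs_ballP[d1 /= d10 h1] := @continuous_cos R p.
have /cvgrPdist_lt/(_ e e0)/nbhs_ballP[d2 /= d20 h2] := @continuous_sin R p.
have d0 : 0 < Num.min d1 d2 by rewrite lt_min d10.
have [p' gp pp'] := on_circle_dense p d0.
exists p'; split => //.
  by apply: h1; rewrite /ball /=; apply: (lt_le_trans pp'); rewrite ge_min lexx.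
by apply: h2; rewrite /ball /=; apply: (lt_le_trans pp'); rewrite ge_min lexx orbT.
Qed.

Lemma circle_sub p : K (r * cos p) (r * sin p).
Proof.
apply: Kclosed => e e0; have e1 : 0 < e / r by rewrite divr_gt0.
have [p' [[gp _] hc hs]] := on_circle_near p e1.
exists (r * cos p'), (r * sin p'); split => //.
  by rewrite -mulrBr normrM gtr0_norm// mulrC -ltr_pdivlMr.
by rewrite -mulrBr normrM gtr0_norm// mulrC -ltr_pdivlMr.
Qed.

Lemma polar (s t : R) : exists p, s = Num.sqrt (s ^+ 2 + t ^+ 2) * cos p /\
  t = Num.sqrt (s ^+ 2 + t ^+ 2) * sin p.
Proof.
set w := Num.sqrt _.
have w2 : w ^+ 2 = s ^+ 2 + t ^+ 2 by rewrite sqr_sqrtr// addr_ge0 ?sqr_ge0.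
have [w0|w0] := eqVneq w 0.
  have s2 := sqr_ge0 s; have t2 := sqr_ge0 t; rewrite w0 expr0n /= in w2.
  have /eqP : s ^+ 2 = 0 by lra.
  have /eqP : t ^+ 2 = 0 by lra.
  by rewrite !sqrf_eq0 => /eqP -> /eqP ->; exists 0; rewrite w0 !mul0r.
have wp : 0 < w by rewrite lt_def w0 sqrtr_ge0.
have sw : -1 <= s / w <= 1.
  by rewrite ler_pdivlMr// ler_pdivrMr//; have t2 := sqr_ge0 t; apply/andP; split; nra.
pose p := acos (s / w).
have cp : w * cos p = s by rewrite /p acosK ?in_itv//= mulrC divfK.
have sp0 : 0 <= sin p by apply: sin_ge0_pi; rewrite acos_ge0// acos_lepi.
have sp : (w * sin p) ^+ 2 = t ^+ 2.
  by rewrite exprMn sin2cos2 mulrBr mulr1 -exprMn cp w2; ring.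
have [t0|t0] := leP 0 t.
  exists p; split => //; apply/eqP; rewrite -(@eqrXn2 R 2) ?sp//.
  by rewrite mulr_ge0// ltW.
exists (- p); rewrite cosN sinN; split => //.
apply/eqP; rewrite mulrN -eqr_oppLR -(@eqrXn2 R 2) ?sqrrN ?sp//.
  by rewrite oppr_ge0 ltW.
by rewrite mulr_ge0// ltW.
Qed.

(** A profile point outside the circle, mixed with a point of the unit disc, would give a dilate of
    a circle point in a nearby direction. Conversely the disc is the union of segments from the
    origin to the circle. *)
Lemma profile_disc (s t : R) : K s t = (s ^+ 2 + t ^+ 2 <= r ^+ 2).
Proof.
have [p [sE tE]] := polar s t.
set w := Num.sqrt _ in sE tE.
have w2 : w ^+ 2 = s ^+ 2 + t ^+ 2 by rewrite sqr_sqrtr// addr_ge0 ?sqr_ge0.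
have w0 : 0 <= w by exact: sqrtr_ge0.
have rp := r0.
have -> : (s ^+ 2 + t ^+ 2 <= r ^+ 2) = (w <= r).
  by rewrite -w2 ler_sqr// nnegrE ltW.
apply/idP/idP => [Kst|wr].
  rewrite leNgt; apply/negP => rw.
  have wp : 0 < w := lt_trans rp rw.
  (* Halfway between [r / w] and 1: [l w] still exceeds [r], and the weight [1 - l] is left for
     correcting the direction. *)
  pose l := (1 + r / w) / 2.
  have rw1 : 0 < r / w < 1 by rewrite divr_gt0// ltr_pdivrMr// mul1r.
  have l01 : 0 < l < 1 by rewrite /l; lra.
  have lw : r < l * w.
    have : r / w < l by rewrite /l; lra.
    by rewrite ltr_pdivrMr.
  have lwp : 0 < l * w by lra.
  (* Chosen so that the correcting point [(x, y)] has coordinates at most 1/2 in absolute value,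
     hence lies in the unit disc. *)
  pose e := (1 - l) / (2 * (l * w)).
  have e0 : 0 < e by rewrite /e divr_gt0 ?mulr_gt0//; lra.
  have eE : e * (l * w) = (1 - l) / 2 by rewrite /e; field; rewrite !gt_eqF//=; lra.
  have [p' [[_ hp'] hc hs]] := on_circle_near p e0.
  apply: (hp' (l * w / r)); first by rewrite ltr_pdivlMr// mul1r.
  have -> : l * w / r * (r * cos p') = l * w * cos p' by field; rewrite gt_eqF.
  have -> : l * w / r * (r * sin p') = l * w * sin p' by field; rewrite gt_eqF.
  pose x := l * w * (cos p' - cos p) / (1 - l).
  pose y := l * w * (sin p' - sin p) / (1 - l).
  have l1 : 1 - l != 0 by apply: lt0r_neq0; lra.
  have l01' : 0 <= l <= 1 by lra.
  have bnd u v : `|u - v| < e -> (l * w * (v - u) / (1 - l)) ^+ 2 <= 1 / 4.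
    move=> uv; rewrite -(real_normK (num_real _)) normrM normfV normrM.
    rewrite (gtr0_norm lwp) (@gtr0_norm _ (1 - l)); last lra.
    rewrite distrC in uv.
    have h : l * w * `|v - u| / (1 - l) <= 2^-1.
      rewrite ler_pdivrMr; last lra.
      by apply: (le_trans (ler_wpM2l (ltW lwp) (ltW uv))); rewrite mulrC eE; lra.
    have h0 : 0 <= l * w * `|v - u| / (1 - l).
      by rewrite divr_ge0 ?mulr_ge0//; lra.
    by nra.
  have Kxy : K x y by apply: Kunit; have := bnd _ _ hc; have := bnd _ _ hs; rewrite -/x -/y; lra.
  have := Kconv Kst Kxy l01'.
  have -> : l * s + (1 - l) * x = l * w * cos p' by rewrite /x sE; field.
  by have -> : l * t + (1 - l) * y = l * w * sin p' by rewrite /y tE; field.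
have l01 : 0 <= w / r <= 1.
  apply/andP; split; first by apply: divr_ge0 => //; exact: ltW.
  by rewrite ler_pdivrMr// mul1r.
have := Kconv (circle_sub p) K0 l01; rewrite !mulr0 !addr0 !mulrA divfK ?gt_eqF//.
by rewrite -sE -tE.
Qed.

End Orbit.
End Planar.

(** * Euclidean geometry of the body *)

Section Dot.
Variable R : realType.
Context {n : nat}.
Implicit Types x y z : 'rV[R]_n.

Lemma dotE x y : dot x y = (x *m y^T) 0 0.
Proof. by rewrite /dot !mxE; apply: eq_bigr => i _; rewrite mxE. Qed.

Lemma mulmx_trE x y : x *m y^T = (dot x y)%:M.
Proof. by apply/matrixP => i j; rewrite !ord1 [RHS]mxE eqxx mulr1n dotE. Qed.

Lemma dotC x y : dot x y = dot y x.
Proof. by apply: eq_bigr => i _; rewrite mulrC. Qed.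

Lemma dotDl x y z : dot (x + y) z = dot x z + dot y z.
Proof. by rewrite !dotE mulmxDl mxE. Qed.

Lemma dotZl a x z : dot (a *: x) z = a * dot x z.
Proof. by rewrite !dotE -scalemxAl mxE. Qed.

Lemma dotNl x z : dot (- x) z = - dot x z.
Proof. by rewrite -scaleN1r dotZl mulN1r. Qed.

Lemma dotDr x y z : dot z (x + y) = dot z x + dot z y.
Proof. by rewrite !(dotC z) dotDl. Qed.

Lemma dotZr a x z : dot z (a *: x) = a * dot z x.
Proof. by rewrite !(dotC z) dotZl. Qed.

Lemma dotNr x z : dot z (- x) = - dot z x.
Proof. by rewrite !(dotC z) dotNl. Qed.

Lemma dot0l x : dot 0 x = 0.
Proof. by rewrite dotE mul0mx mxE. Qed.

Definition dotRE := (dotDl, dotDr, dotZl, dotZr, dotNl, dotNr).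

Lemma dot_ge0 x : 0 <= dot x x.
Proof. by apply: sumr_ge0 => i _; rewrite -expr2 sqr_ge0. Qed.

Lemma dot_eq0 x : (dot x x == 0) = (x == 0).
Proof.
apply/idP/eqP => [|->]; last by rewrite dot0l.
rewrite psumr_eq0 => [/allP h|i _]; last by rewrite -expr2 sqr_ge0.
apply/rowP => i; rewrite mxE; apply/eqP; rewrite -sqrf_eq0 expr2.
exact: h (mem_index_enum i).
Qed.

Lemma dot_gt0 x : x != 0 -> 0 < dot x x.
Proof. by rewrite lt_def dot_ge0 dot_eq0 => ->. Qed.

Lemma enorm_le x a : 0 <= a -> (enorm x <= a) = (dot x x <= a ^+ 2).
Proof.
move=> a0; rewrite /enorm -[a in LHS]ger0_norm// -sqrtr_sqr ler_sqrt//.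
exact: sqr_ge0.
Qed.

Lemma mulmx_dot x y z : x *m (y^T *m z) = dot x y *: z.
Proof. by rewrite mulmxA mulmx_trE mul_scalar_mx. Qed.

Lemma exists_unit x : x != 0 -> exists2 a, 0 < a & dot (a *: x) (a *: x) = 1.
Proof.
move=> x0; have d0 := dot_gt0 x0.
exists (Num.sqrt (dot x x))^-1; first by rewrite invr_gt0 sqrtr_gt0.
rewrite dotZl dotZr mulrA -invfM -expr2 sqr_sqrtr; last exact: ltW.
by rewrite mulVf// gt_eqF.
Qed.

End Dot.

(** * Half turns and orthonormal frames *)

Section HalfTurn.
Variable R : realType.

Lemma dot_mulmx m n (x y : 'rV[R]_m) (N : 'M[R]_(m, n)) :
  N *m N^T = 1%:M -> dot (x *m N) (y *m N) = dot x y.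
Proof. by move=> NN; rewrite !dotE trmx_mul mulmxA -(mulmxA x) NN mulmx1. Qed.

Definition reflection n (a : 'rV[R]_n) : 'M[R]_n := 1%:M - 2 *: (a^T *m a).

Lemma reflection_tr n (a : 'rV[R]_n) : (reflection a)^T = reflection a.
Proof. by rewrite /reflection linearB /= trmx1 linearZ /= trmx_mul trmxK. Qed.

Lemma mulmx_reflection n (x a : 'rV[R]_n) :
  x *m reflection a = x - (2 * dot x a) *: a.
Proof. by rewrite /reflection mulmxBr mulmx1 -scalemxAr mulmx_dot scalerA. Qed.

Lemma row_ext n (M N : 'M[R]_n) : (forall x : 'rV[R]_n, x *m M = x *m N) -> M = N.
Proof.
by move=> h; apply/row_matrixP => i; rewrite !rowE.
Qed.

Lemma reflectionK n (a : 'rV[R]_n) : dot a a = 1 -> reflection a *m reflection a = 1%:M.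
Proof.
move=> a1; apply: row_ext => x; rewrite mulmxA !mulmx_reflection !dotRE a1 mulmx1.
by apply/rowP => i; rewrite !mxE; ring.
Qed.

(** For orthonormal [e] and [u], the rotation by [pi] that fixes their plane and negates its
    orthogonal complement. These are the only rotations applied to the body. *)
Definition half_turn n (e u : 'rV[R]_n) : 'M[R]_n := - (reflection e *m reflection u).

Lemma mulmx_half_turn n (e u x : 'rV[R]_n) : dot e u = 0 ->
  x *m half_turn e u = (2 * dot x e) *: e + (2 * dot x u) *: u - x.
Proof.
move=> eu; rewrite /half_turn mulmxN mulmxA !mulmx_reflection !dotRE eu.
by apply/rowP => i; rewrite !mxE; ring.
Qed.

Lemma half_turn_orthogonal n (e u : 'rV[R]_n) : dot e e = 1 -> dot u u = 1 ->
  half_turn e u *m (half_turn e u)^T = 1%:M.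
Proof.
move=> e1 u1; rewrite /half_turn linearN /= trmx_mul !reflection_tr mulNmx mulmxN opprK.
by rewrite mulmxA -(mulmxA (reflection e)) reflectionK// mulmx1 reflectionK.
Qed.

(* The two factors are conjugate, by the reflection exchanging [e] and [u]. *)
Lemma det_half_turn (e u : 'rV[R]_4) : dot e e = 1 -> dot u u = 1 -> dot e u = 0 ->
  \det (half_turn e u) = 1.
Proof.
move=> e1 u1 eu.
have ue : dot u e = 0 by rewrite dotC.
pose K : 'M[R]_4 := 1%:M - (e - u)^T *m (e - u).
have KE x : x *m K = x - dot x (e - u) *: (e - u).
  by rewrite /K mulmxBr mulmx1 mulmx_dot.
have KK : K *m K = 1%:M.
  apply: row_ext => x; rewrite mulmxA mulmx1 !KE !dotRE e1 u1 eu ue.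
  by apply/rowP => i; rewrite !mxE; ring.
have conj : reflection u = K *m reflection e *m K.
  apply: row_ext => x; rewrite !mulmxA !(mulmx_reflection, KE) !dotRE e1 u1 eu ue.
  by apply/rowP => i; rewrite !mxE; ring.
have d2 (M : 'M[R]_4) : M *m M = 1%:M -> \det M ^+ 2 = 1.
  by move=> MM; rewrite expr2 -det_mulmx MM det1.
rewrite /half_turn -scaleN1r detZ conj !det_mulmx.
transitivity ((-1 : R) ^+ 4 * (\det (reflection e) ^+ 2 * \det K ^+ 2)).
  by ring.
by rewrite !d2// ?reflectionK//; ring.
Qed.

Lemma exists_unit_orthogonal (x y : 'rV[R]_4) :
  exists2 u : 'rV[R]_4, dot u u = 1 & dot u x = 0 /\ dot u y = 0.
Proof.
pose B : 'M[R]_(4, 1 + 1) := row_mx x^T y^T.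
have k0 : kermx B != 0.
  rewrite -mxrank_eq0 mxrank_ker; have := rank_leq_col B.
  by case: (\rank B) => [|[|[|]]].
have nz : nz_row (kermx B) != 0 by rewrite nz_row_eq0.
have /sub_kermxP := nz_row_sub (kermx B).
rewrite mul_mx_row !mulmx_trE => h.
have [a a0 a1] := exists_unit nz.
have [hx hy] : (dot (nz_row (kermx B)) x)%:M = 0 :> 'M[R]_1 /\
    (dot (nz_row (kermx B)) y)%:M = 0 :> 'M[R]_1.
  by apply: eq_row_mx; rewrite row_mx0.
exists (a *: nz_row (kermx B)) => //; rewrite !dotZl.
have z (c : R) : c%:M = 0 :> 'M[R]_1 -> c = 0.
  by move/matrixP/(_ 0 0); rewrite !mxE eqxx mulr1n.
by rewrite (z _ hx) (z _ hy) mulr0.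
Qed.

(* By the reflection taking the first basis vector to [u]. *)
Lemma exists_hyperplane_frame (u : 'rV[R]_4) : dot u u = 1 ->
  exists N : 'M[R]_(3, 4), [/\ N *m N^T = 1%:M, u *m N^T = 0 &
    forall x, dot x u = 0 -> x = x *m N^T *m N].
Proof.
move=> u1.
have [Q [QQ Qu]] : exists Q : 'M[R]_(1 + 3, 4), Q *m Q^T = 1%:M /\ usubmx Q = u.
  pose e0 : 'rV[R]_4 := delta_mx 0 0.
  have e01 : dot e0 e0 = 1.
    by rewrite dotE /e0 trmx_delta mul_delta_mx mxE !eqxx.
  have usub (Q : 'M[R]_(1 + 3, 4)) : usubmx Q = e0 *m Q.
    rewrite /e0 -rowE; apply/matrixP => i j; rewrite !mxE ord1; congr (Q _ _).
    exact/val_inj.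
  have [ue|ue] := eqVneq u e0.
    by exists 1%:M; rewrite trmx1 mulmx1 usub mulmx1.
  have d0 : e0 - u != 0 by rewrite subr_eq0 eq_sym.
  have [a a0 a1] := exists_unit d0.
  exists (reflection (a *: (e0 - u)) : 'M[R]_(1 + 3, 4)); rewrite reflection_tr reflectionK//; split => //.
  rewrite usub mulmx_reflection scalerA.
  move: a1; rewrite !dotRE e01 u1 (dotC u e0) => h.
  have -> : 2 * (a * (1 + - dot e0 u)) * a = 1 by rewrite -[RHS]h; ring.
  by rewrite scale1r subKr.
have QQ' : Q^T *m Q = 1%:M by apply: mulmx1C.
have QE : Q = col_mx u (dsubmx Q) by rewrite -Qu vsubmxK.
set N := dsubmx Q in QE.
move: QQ QQ'; rewrite QE tr_col_mx => QQ; rewrite mul_row_col => NuN.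
move: QQ; rewrite mul_col_row scalar_mx_block => /eq_block_mx[_ uN _ NN].
exists N; split => // x xu.
have := congr1 (mulmx x) NuN; rewrite mulmx1 mulmxDr mulmx_dot xu scale0r add0r.
by rewrite mulmxA.
Qed.

End HalfTurn.

(** * The planar profile and the topology of the body *)

Section Profile.
Variable R : realType.

(** The value [q s] is the square of the largest element of the fibre over [s], attained because [K]
    is closed and bounded. *)
Lemma profile_exists (K : R -> R -> Prop) (M : R) :
  (forall s t, K s t -> K s (- t)) ->
  (forall s t s' t' l, K s t -> K s' t' -> 0 <= l <= 1 ->
     K (l * s + (1 - l) * s') (l * t + (1 - l) * t')) ->
  (forall s t, K s t -> s ^+ 2 + t ^+ 2 <= M ^+ 2) ->
  (forall s t, (forall e, 0 < e ->
     exists s' t', [/\ `|s - s'| < e, `|t - t'| < e & K s' t']) -> K s t) ->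
  exists q : R -> R, [/\ measurable_fun setT q,
    (forall s t, K s t <-> t ^+ 2 <= q s) & forall s, q s = -1 \/ 0 <= q s].
Proof.
move=> KN Kconv Kbd Kcl.
have pointwise s : exists m : R,
    (forall t, K s t <-> t ^+ 2 <= m) /\ (m = -1 \/ 0 <= m).
  have [[t0 Kt0]|noK] := pselect (exists t, K s t); last first.
    (* A negative value encodes an empty fibre; fixing it makes [q] determined by [K], as
       measurability and evenness require. *)
    exists (-1); split; last by left.
    move=> t; split => [Kt|h]; first by exfalso; apply: noK; exists t.
    by have := sqr_ge0 t; lra.
  pose S := [set t | K s t].
  have Sub : ubound S `|M|.
    move=> t /Kbd h; apply: le_trans (ler_norm _) _.
    rewrite -ler_sqr ?nnegrE// !real_normK ?num_real//.
    by have := sqr_ge0 s; lra.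
  have hS : has_sup S by split; [exists t0|exists (`|M|)].
  have KT : K s (sup S).
    apply: Kcl => e e0; have [t' Kt' lt] := sup_adherent e0 hS.
    exists s, t'; rewrite subrr normr0; split => //.
    have t'S : t' <= sup S by apply: ub_le_sup => //; exists (`|M|).
    by rewrite ger0_norm; lra.
  have leT t : K s t -> `|t| <= sup S.
    move=> Kt; rewrite ler_norml lerNl.
    by apply/andP; split; apply: ub_le_sup; [exists (`|M|)|exact: KN|exists (`|M|)|].
  have T0 : 0 <= sup S := le_trans (normr_ge0 _) (leT _ Kt0).
  exists (sup S ^+ 2); split; last by right; exact: sqr_ge0.
  move=> t; split => [/leT h|].
    by rewrite -(real_normK (num_real t)) ler_sqr ?nnegrE.
  rewrite -(real_normK (num_real t)) ler_sqr ?nnegrE// ler_norml => /andP[h1 h2].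
  have [T1|T1] := eqVneq (sup S) 0.
    by have -> : t = sup S by lra.
  have Tp : 0 < sup S by rewrite lt_def T1.
  pose l := (t + sup S) / (2 * sup S).
  have l01 : 0 <= l <= 1.
    apply/andP; split; first by apply: divr_ge0; lra.
    by rewrite ler_pdivrMr; lra.
  have := Kconv _ _ _ _ _ KT (KN _ _ KT) l01.
  have -> : l * s + (1 - l) * s = s by ring.
  by have -> : l * sup S + (1 - l) * - sup S = t by rewrite /l; field.
have [q hq] := choice pointwise.
exists q; split => [|s t|s]; [|exact: (hq s).1|exact: (hq s).2].
have closed_level t : closed [set s | K s t].
  move=> s /= cl; apply: Kcl => e e0.
  have [s' [Ks' bs']] := cl _ (nbhsx_ballx s e e0).
  by exists s', t; rewrite subrr normr0.
(* Each set where [q >= c] is closed: everything for [c <= -1], the non-empty fibres for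
   [-1 < c < 0], and a level of [K] for [c >= 0]. *)
apply: (measurability (@RGenCInfty.G R)); first exact: RGenCInfty.measurableE.
move => _ [_ [c ->] <-].
rewrite setTI.
have [c1|c1] := leP c (-1).
  rewrite [X in measurable X](_ : _ = setT)//; apply/seteqP; split => // s _ /=.
  by rewrite in_itv /= andbT; have [->|] := (hq s).2; lra.
have [c0|c0] := leP 0 c.
  rewrite [X in measurable X](_ : _ = [set s | K s (Num.sqrt c)]).
    exact: closed_measurable.
  by apply/seteqP; split => s /=; rewrite in_itv /= andbT => h;
    [apply/(hq s).1; rewrite sqr_sqrtr|have /(hq s).1 := h; rewrite sqr_sqrtr].
rewrite [X in measurable X](_ : _ = [set s | K s 0]); first exact: closed_measurable.
apply/seteqP; split => s /=; rewrite in_itv /= andbT => h.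
  by apply/(hq s).1; rewrite expr0n /=; have [e|] := (hq s).2; lra.
by have /(hq s).1 := h; rewrite expr0n /=; lra.
Qed.

Lemma dot_continuous : continuous (fun x : 'rV[R]_4 => dot x x).
Proof.
have c (i : 'I_4) : continuous (fun x : 'rV[R]_4 => x 0 i * x 0 i).
  by move=> x; apply: (@continuousM _ _ (fun y : 'rV[R]_4 => y 0 i)); exact: (@coord_continuous R 1 4 0 i x).
have -> : (fun x : 'rV[R]_4 => dot x x) = (fun x => x 0 0 * x 0 0 + (x 0 1 * x 0 1 +
    (x 0 (2 : 'I_4) * x 0 (2 : 'I_4) + x 0 (3 : 'I_4) * x 0 (3 : 'I_4)))).
  apply/funext => x; rewrite /dot !big_ord_recl big_ord0 addr0.
  by congr (_ + (_ + (_ + _))); congr (x 0 _ * x 0 _); exact/val_inj.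
have cD (f g : 'rV[R]_4 -> R) : continuous f -> continuous g -> continuous (fun x => f x + g x).
  by move=> cf cg x; apply: (@cvgD _ _ _ _ (nbhs_filter x)); [exact: cf|exact: cg].
by apply: (cD _ _ (c 0)); apply: (cD _ _ (c 1)); apply: (cD _ _ (c 2)); exact: c.
Qed.

Lemma compact_dot_bounded (C : set 'rV[R]_4) : compact C ->
  exists M : R, forall x, C x -> dot x x <= M ^+ 2.
Proof.
move=> cC.
have : compact ((fun x : 'rV[R]_4 => dot x x) @` C).
  by apply: continuous_compact => //; apply: continuous_subspaceT; exact: dot_continuous.
move=> /compact_bounded[N [_ hN]].
exists (`|N| + 1) => x Cx.
have := hN (`|N| + 1) _ (dot x x).
rewrite ltr_pwDr ?ler_norm// => /(_ isT) /=.
have Ix : (exists2 y, C y & dot y y = dot x x) by exists x.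
move=> /(_ Ix); rewrite (ger0_norm (dot_ge0 x)) => h.
by apply: (le_trans h); have := normr_ge0 N; nra.
Qed.

Lemma closed_unit_ball : closed [set x : 'rV[R]_4 | dot x x <= 1].
Proof.
have -> : [set x : 'rV[R]_4 | dot x x <= 1] = (fun x => dot x x) @^-1` `]-oo, 1]%classic.
  by apply/seteqP; split => x /=; rewrite in_itv.
apply: preimage_closed; last exact: interval_closed.
by move=> x _; exact: dot_continuous.
Qed.

(** Near each [x] of the ball, [(1 + i) x'] stays in [C] for [x'] close to [x] and small [i > 0];
    compactness makes the range of [i] uniform. *)
Lemma dilated_ball (C : set 'rV[R]_4) : compact C -> [set x | dot x x <= 1] `<=` C° ->
  exists2 eps : R, 0 < eps & forall x, dot x x <= (1 + eps) ^+ 2 -> C x.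
Proof.
move=> cC BC.
have cB : compact [set x : 'rV[R]_4 | dot x x <= 1].
  apply: (subclosed_compact closed_unit_ball cC).
  by apply: subset_trans BC _; exact: interior_subset.
have /compact_near_coveringP cov := cB.
have := cov R (0^'+) (fun i x => C ((1 + i) *: x)) _.
have hyp x : dot x x <= 1 -> \forall x' \near x & i \near (0 : R)^'+, C ((1 + i) *: x').
  move=> /BC Cx.
  have ct : (fun p : 'rV[R]_4 * R => (1 + p.2) *: p.1) @ (nbhs x, nbhs (0 : R)) --> x.
    have : (fun p : 'rV[R]_4 * R => (1 + p.2) *: p.1) @ (nbhs x, nbhs (0 : R)) -->
        (1 + (0 : R)) *: x.
      apply: cvgZ; last exact: cvg_fst.
      by apply: cvgD; [exact: cvg_cst|exact: cvg_snd].
    by rewrite addr0 scale1r.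
  have [[P Q] /= [nP nQ] PQ] := ct _ Cx.
  exists (P, Q) => //=; split => //.
  exact: cvg_at_right_filter nQ.
move=> /(_ _ hyp) h.
have {h} [e /= e0 he] := h.
have e20 : 0 < e / 2 by lra.
exists (e / 2) => // x hx.
have he2 := he (e / 2) _ e20.
have k0 : 0 < 1 + e / 2 by lra.
have -> : x = (1 + e / 2) *: ((1 + e / 2)^-1 *: x) by rewrite scalerA mulfV ?gt_eqF// scale1r.
apply: he2.
  by rewrite /ball /= sub0r normrN gtr0_norm//; lra.
rewrite /= dotZl dotZr mulrA -invfM -expr2 mulrC ler_pdivrMr ?mul1r//.
exact: exprn_gt0.
Qed.

Lemma closed_plane_section (C : set 'rV[R]_4) (e v : 'rV[R]_4) (s t : R) : closed C ->
  (forall d, 0 < d -> exists s' t', [/\ `|s - s'| < d, `|t - t'| < d & C (s' *: e + t' *: v)]) ->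
  C (s *: e + t *: v).
Proof.
move=> cC h.
have cl : closed ((fun p : R * R => p.1 *: e + p.2 *: v) @^-1` C).
  apply: preimage_closed => // p _.
  by apply: cvgD; apply: cvgZr_tmp; [exact: cvg_fst|exact: cvg_snd].
apply: (cl (s, t)) => B /nbhs_ballP[d /= d0 dB].
have [s' [t' [hs ht Cst]]] := h d d0.
by exists (s', t'); split => //; apply: dB.
Qed.

End Profile.

(** * Invariance under rotations about an axis through the origin *)

Section Revolution.
Variable R : realType.
Implicit Types (C : set 'rV[R]_4) (e : 'rV[R]_4).

(** Let [p0] be the foot of the perpendicular from the origin to the axis. A suitable half turn
    about a plane through the axis, alternated twice with the central symmetry, is the translation
    by [4 p0]; boundedness forces [p0 = 0]. *)
Lemma axis_through_0 C M : C 0 -> (forall x, C x -> dot x x <= M ^+ 2) ->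
  symmetric_set C -> of_revolution C ->
  exists2 e, dot e e = 1 & forall u, dot u u = 1 -> dot e u = 0 ->
    forall x, C x -> C (x *m half_turn e u).
Proof.
move=> C0 CM Csym [L [[p [d [d0 LE]]] rev]].
have CN x : C x -> C (- x) by move=> Cx; rewrite -Csym; exists x.
have [e e1 [b dE]] : exists2 e, dot e e = 1 & exists b, d = b *: e.
  have [a a0 e1] := exists_unit d0; exists (a *: d) => //; exists a^-1.
  by rewrite scalerA mulVf ?scale1r// gt_eqF.
have [p0 p0E] : exists p0, p0 = p - dot p e *: e by eexists.
have p0e : dot p0 e = 0 by rewrite p0E !dotRE e1 mulr1 subrr.
have turn u : dot u u = 1 -> dot e u = 0 ->
    forall x, C x -> C (p0 + (x - p0) *m half_turn e u).
  move=> u1 eu x Cx.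
  pose f (y : 'rV[R]_4) := (p0 - p0 *m half_turn e u) + y *m half_turn e u.
  have fiso : is_direct_isometry f.
    exists (p0 - p0 *m half_turn e u), (half_turn e u); split => //.
      exact: half_turn_orthogonal.
    exact: det_half_turn.
  have ffix y : L y -> f y = y.
    rewrite LE => -[s _ <-].
    have -> : p + s *: d = p0 + (dot p e + s * b) *: e.
      by rewrite p0E dE; apply/rowP => i; rewrite !mxE; ring.
    rewrite /f mulmxDl -scalemxAl; have -> : e *m half_turn e u = e.
      by rewrite mulmx_half_turn// e1 eu; apply/rowP => i; rewrite !mxE; ring.
    by apply/rowP => i; rewrite !mxE; ring.
  rewrite -(rev f fiso ffix); exists x => //.
  by rewrite /f mulmxBl; apply/rowP => i; rewrite !mxE; ring.
(* Being orthogonal to [p0] as well, [u] gives a half turn that negates [p0], so that the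
   displacements add up instead of cancelling. *)
have [u u1 [ue up0]] := exists_unit_orthogonal e p0.
have eu : dot e u = 0 by rewrite dotC.
have p0u : dot p0 u = 0 by rewrite dotC.
have shift x : C x -> C (x + 4 *: p0).
  move=> Cx; have := turn u u1 eu _ (CN _ (turn u u1 eu _ (CN _ Cx))).
  rewrite !(mulmx_half_turn, dotRE)// !(e1, u1, eu, ue, p0e, p0u).
  suff : forall y z : 'rV[R]_4, y = z -> C y -> C z.
    apply; apply/rowP => i; rewrite !mxE; ring.
  by move=> y z ->.
have iter_shift (k : nat) : C ((4 * k%:R) *: p0).
  elim: k => [|k IH]; first by rewrite mulr0 scale0r.
  by have := shift _ IH; rewrite -scalerDl -[k.+1%:R]natr1 mulrDr mulr1.
have p00 : p0 = 0.
  apply/eqP; rewrite -dot_eq0; apply/eqP/le_anti; rewrite dot_ge0 andbT leNgt; apply/negP => pp.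
  have bd k := CM _ (iter_shift k).
  pose k := (Num.truncn (M ^+ 2 / dot p0 p0)).+1.
  have : M ^+ 2 / dot p0 p0 < k%:R := truncnS_gt _.
  rewrite ltr_pdivrMr// => h; have := bd k; rewrite !dotRE.
  have k1 : 1 <= k%:R :> R by rewrite ler1n.
  have kk : k%:R * dot p0 p0 <= k%:R * (k%:R * dot p0 p0).
    by rewrite ler_peMl// mulr_ge0// ltW.
  have : 0 < dot p0 p0 * k%:R by rewrite mulr_gt0// ltr0n.
  by lra.
exists e => // u' u'1 eu' x Cx.
by have := turn u' u'1 eu' x Cx; rewrite p00 add0r subr0.
Qed.

(** The components [y] and [y'] orthogonal to the axis have equal length, so the half turn about the
    plane of [e] and [y + y'] exchanges them. If [y + y' = 0], a half turn about the plane of [e]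
    and a vector orthogonal to [x] negates [y]. *)
Lemma revolution_invariant C e : dot e e = 1 ->
  (forall u, dot u u = 1 -> dot e u = 0 -> forall x, C x -> C (x *m half_turn e u)) ->
  forall x x', dot x e = dot x' e -> dot x x = dot x' x' -> C x -> C x'.
Proof.
move=> e1 turn x x' xe xx Cx.
have [y yE] : exists y, y = x - dot x e *: e by eexists.
have [y' y'E] : exists y', y' = x' - dot x e *: e by eexists.
have [yy|yy] := eqVneq (y + y') 0.
  have [u u1 [ue ux]] := exists_unit_orthogonal e x.
  have eu : dot e u = 0 by rewrite dotC.
  have := turn u u1 eu x Cx; rewrite mulmx_half_turn// (dotC x u) ux.
  suff -> : (2 * dot x e) *: e + (2 * 0) *: u - x = x' by [].
  have -> : x' = (2 * dot x e) *: e - x + (y + y').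
    by rewrite yE y'E; apply/rowP => i; rewrite !mxE; ring.
  by rewrite yy; apply/rowP => i; rewrite !mxE; ring.
have [u u1 [a uE]] : exists2 u, dot u u = 1 & exists a, u = a *: (y + y').
  by have [a a0 a1] := exists_unit yy; exists (a *: (y + y')) => //; exists a.
have ye : dot e y = 0 by rewrite yE !dotRE e1 (dotC e x); ring.
have y'e : dot e y' = 0 by rewrite y'E !dotRE e1 (dotC e x') xe; ring.
have eu : dot e u = 0 by rewrite uE !dotRE ye y'e addr0 mulr0.
have yyE : dot y y = dot y' y'.
  by rewrite yE y'E !dotRE e1 (dotC e x) (dotC e x') -xe xx; ring.
have := turn u u1 eu x Cx; rewrite mulmx_half_turn//.
suff -> : (2 * dot x e) *: e + (2 * dot x u) *: u - x = x' by [].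
have xu : dot x u = dot y u.
  by rewrite -[x in LHS](subrK (dot x e *: e)) -yE dotDl dotZl eu mulr0 addr0.
have k : 2 * dot x u * a = 1.
  rewrite xu -[RHS]u1 uE !dotRE -yyE (dotC y' y); ring.
have -> : (2 * dot x u) *: u = y + y' by rewrite {2}uE scalerA k scale1r.
by rewrite yE y'E; apply/rowP => i; rewrite !mxE; ring.
Qed.

End Revolution.

(** * The volume of a tangent section *)

Section SectionVolume.
Variable R : realType.
Local Notation mu := (@lebesgue_measure R).

Lemma vec3_surj (x : 'rV[R]_3) : exists y : R * R * R, vec3 y = x.
Proof.
exists (x 0 0, x 0 1, x 0 2); apply/rowP => i; rewrite mxE /=.
by case: i => [[|[|[|//]]] hi] /=; congr (x 0 _); exact/val_inj.
Qed.

Lemma vec3D (y c : R * R * R) :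
  vec3 (y.1.1 + c.1.1, y.1.2 + c.1.2, y.2 + c.2) = vec3 y + vec3 c.
Proof.
by apply/rowP => i; rewrite !mxE /=; case: i => [[|[|[|//]]] hi].
Qed.

Lemma dot_vec3 (y z : R * R * R) :
  dot (vec3 y) (vec3 z) = y.1.1 * z.1.1 + y.1.2 * z.1.2 + y.2 * z.2.
Proof.
by rewrite /dot !big_ord_recl big_ord0 !mxE /= addr0 addrA.
Qed.

(** Guarantees that the [get] in [vol3] returns a genuine frame. *)
Lemma frames_hyperplane (u : 'rV[R]_4) : dot u u = 1 ->
  exists f, frames [set x | dot u x = 1] f.
Proof.
move=> u1; have [N [NN uN Nu]] := exists_hyperplane_frame u1.
exists (u, N); split => //=; apply/seteqP; split => [_ [y _ <-]|x /= ux].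
  have := dotE u (vec3 y *m N); rewrite trmx_mul mulmxA uN mul0mx mxE => h.
  by rewrite /= /affine_map3 /= dotDr u1 h addr0.
have xu : dot (x - u) u = 0 by rewrite !dotRE u1 (dotC x u) ux subrr.
have [y yE] := vec3_surj ((x - u) *m N^T).
by exists y => //; rewrite /affine_map3 /= yE -Nu// subrKC.
Qed.

(** The frame chosen by [get] is arbitrary, so the section is normalized in coordinates: a
    translation moves the origin to the point of tangency [u], and [lebesgue3_axial] replaces the
    direction [w], along which alone the axis coordinate varies, by the third axis. *)
Lemma section_volume (C : set 'rV[R]_4) (q : R -> R) (e v : 'rV[R]_4) (t : R) :
  measurable_fun setT q -> dot e e = 1 -> dot v v = 1 -> dot e v = 0 ->
  (forall x, C x <-> dot x x - dot x e ^+ 2 <= q (dot x e)) ->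
  let H := [set x | dot (cos t *: e + sin t *: v) x = 1] in
  vol3 H (C `&` H) = (\int[mu]_z (pi * Num.max 0
    (q (cos t - z * sin t) - (sin t + z * cos t) ^+ 2))%:E)%E.
Proof.
move=> mq e1 v1 ev hC H.
have cs := cos2Dsin2 t; have ve : dot v e = 0 by rewrite dotC.
have [u uE] : exists u, u = cos t *: e + sin t *: v by eexists.
have [w wE] : exists w, w = - sin t *: e + cos t *: v by eexists.
have u1 : dot u u = 1 by rewrite uE !dotRE e1 v1 ev ve -[RHS]cs; ring.
have w1 : dot w w = 1 by rewrite wE !dotRE e1 v1 ev ve -[RHS]cs; ring.
have uw : dot u w = 0 by rewrite uE wE !dotRE e1 v1 ev ve; ring.
have eE : e = cos t *: u - sin t *: w.
  rewrite uE wE -[LHS]scale1r -cs; apply/rowP => i; rewrite !mxE; ring.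
have HE : H = [set x | dot u x = 1] by rewrite uE.
have [N [f1 [fN [NN frange]]]] : exists N f1, get (frames H) = (f1, N) /\
    frames H (f1, N).
  have : frames H (get (frames H)) by apply: getPex; rewrite HE; exact: frames_hyperplane.
  by case: (get (frames H)) => f1 N h; exists N, f1.
have fH y : dot u (f1 + vec3 y *m N) = 1.
  suff : H (f1 + vec3 y *m N) by rewrite HE.
  by rewrite -frange; exists y.
have uN : forall y, dot u (vec3 y *m N) = 0.
  move=> y; have := fH y; have := fH (0, 0, 0).
  have -> : vec3 (0, 0, 0) = 0 :> 'rV[R]_3.
    by apply/rowP => i; rewrite !mxE; case: i => [[|[|[|//]]] hi].
  by rewrite mul0mx addr0 dotDr => ->; lra.
have surj x : dot u x = 1 -> exists y, x = f1 + vec3 y *m N.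
  move=> ux; have : H x by rewrite HE.
  by rewrite -frange => -[y _ <-]; exists y.
(* Coordinates of the point of tangency; subtracted from those of [u + w], they give the unit vector
   [n] representing [w] in the frame. *)
have [c0 c0E] := surj _ u1.
have [n0 n0E] : exists n0, u + w = f1 + vec3 n0 *m N by apply: surj; rewrite dotDr u1 uw addr0.
have [n nE] := vec3_surj (vec3 n0 - vec3 c0).
have nN : vec3 n0 *m N = u + w - f1 by rewrite n0E addrAC subrr add0r.
have cN : vec3 c0 *m N = u - f1 by rewrite c0E addrAC subrr add0r.
have wn : w = vec3 n *m N.
  by rewrite nE mulmxBl nN cN; apply/rowP => i; rewrite !mxE; ring.
have [c cE] := vec3_surj (- vec3 c0).
have f1E y : f1 + vec3 y *m N = u + (vec3 y + vec3 c) *m N.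
  rewrite cE mulmxDl mulNmx cN; set z := _ *m N.
  by apply/rowP => i; rewrite !mxE; ring.
have n_unit : n.1.1 ^+ 2 + n.1.2 ^+ 2 + n.2 ^+ 2 = 1.
  by rewrite -w1 wn dot_mulmx// dot_vec3 !expr2.
(* A point of [H] at position [a] along [w] has axis coordinate [cos t - a sin t], and its squared
   norm is 1 plus its squared distance to [u]; these account for the last two terms. *)
pose h (a : R) : R := q (cos t - a * sin t) + (cos t - a * sin t) ^+ 2 - 1.
have CE z : C (u + vec3 z *m N) <->
    z.1.1 ^+ 2 + z.1.2 ^+ 2 + z.2 ^+ 2 <= h (n.1.1 * z.1.1 + n.1.2 * z.1.2 + n.2 * z.2).
  have zw : dot (vec3 z *m N) w = n.1.1 * z.1.1 + n.1.2 * z.1.2 + n.2 * z.2.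
    by rewrite wn dot_mulmx// dotC dot_vec3.
  have ze : dot (u + vec3 z *m N) e = cos t - dot (vec3 z *m N) w * sin t.
    by rewrite eE !dotRE u1 uw (dotC _ u) uN; ring.
  have zz : dot (u + vec3 z *m N) (u + vec3 z *m N) =
      1 + (z.1.1 ^+ 2 + z.1.2 ^+ 2 + z.2 ^+ 2).
    by rewrite !dotRE u1 (dotC _ u) uN dot_mulmx// dot_vec3 !expr2; ring.
  by rewrite (hC _) ze zz zw /h; split; lra.
have mh : measurable_fun setT h.
  have maff : measurable_fun setT (fun a : R => cos t - a * sin t) by mfun.
  apply: measurable_funB => //; apply: measurable_funD; last exact: measurable_funX.
  exact: (measurableT_comp mq maff).
pose S := [set z : R * R * R | z.1.1 ^+ 2 + z.1.2 ^+ 2 + z.2 ^+ 2 <=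
  h (n.1.1 * z.1.1 + n.1.2 * z.1.2 + n.2 * z.2)].
have mS : measurable S.
  apply: measurable_le_fun; first by mfun.
  apply: (measurableT_comp mh); mfun.
have -> : vol3 H (C `&` H) = lebesgue3
    ((fun p => (p.1.1 + c.1.1, p.1.2 + c.1.2, p.2 + c.2)) @^-1` S).
  rewrite /vol3 fN; congr (lebesgue3 _); apply/seteqP; split => y /=; rewrite /affine_map3 /= f1E -vec3D.
    by move=> [/CE].
  move=> hS; split; first exact/CE.
  have hu z : [set x | dot u x = 1] (u + vec3 z *m N) by rewrite /= dotDr u1 uN addr0.
  by rewrite -HE in hu; exact: hu.
apply: etrans (lebesgue3_translation c mS) _.
apply: etrans (lebesgue3_axial mh n_unit) _.
apply: etrans (lebesgue3_axial_integral mh) _.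
apply: eq_integral => z _; congr (pi * Num.max 0 _)%:E.
rewrite /h -[z ^+ 2]mul1r -[X in X * z ^+ 2]cs.
transitivity (q (cos t - z * sin t) + (cos t - z * sin t) ^+ 2 - (cos t ^+ 2 + sin t ^+ 2)
   - (cos t ^+ 2 + sin t ^+ 2) * z ^+ 2); first by rewrite cs.
ring.
Qed.

(** A common point of the hyperplane and the interior could be moved by a small multiple of [u]
    within the ball, to a point whose inner product with [u] exceeds 1. *)
Lemma tangent_hyperplane_ball (u : 'rV[R]_4) : dot u u = 1 ->
  tangent_hyperplane [set x | dot u x = 1] (closed_eball 0 1).
Proof.
move=> u1; have ballE x : closed_eball 0 1 x = (dot x x <= 1) :> Prop.
  by rewrite /closed_eball /= subr0 enorm_le// expr1n.
split.
- exists u, 1; split => //; apply/eqP => u0.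
  by move: u1; rewrite u0 dot0l => /esym/eqP; rewrite oner_eq0.
- by exists u; split => //=; rewrite ballE u1.
apply/seteqP; split => // x [/= ux xi].
have ct : (fun s : R => x + s *: u) @ 0 --> x + (0 : R) *: u.
  by apply: cvgD; [exact: cvg_cst|apply: cvgZr_tmp; exact: cvg_id].
rewrite scale0r addr0 in ct.
have /nbhs_ballP[d /= d0 hd] := ct _ xi.
have := hd (d / 2); rewrite /ball /= sub0r normrN gtr0_norm; last lra.
have d2 : d / 2 < d by lra.
move=> /(_ d2); rewrite ballE => le1.
have := dot_ge0 (x + (d / 2) *: u - u); move: le1.
by rewrite !dotRE u1 (dotC x u) ux; nra.
Qed.

End SectionVolume.

(** Here [L = sqrt (R_A^2 - 1)] is the cube root of [A / omega3], so that [A > 8 omega3] becomes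
    [L > 2]. *)
Lemma RA_tan (R : realType) (A : R) : 8 * @omega3 R < A ->
  exists2 L : R, 2 < L & [/\ A = 4 / 3 * pi * L ^+ 3, RA A = Num.sqrt (1 + L ^+ 2) &
    atan L = gamma A * pi].
Proof.
have w0 : 0 < omega3 R by rewrite mulr_gt0 ?pi_gt0//; lra.
move=> A8; have Aw : 8 < A / omega3 R by rewrite ltr_pdivlMr.
set a := A / omega3 R in Aw.
have a0 : 0 < a by lra.
pose L := a `^ 3^-1.
have L3 : L ^+ 3 = a.
  by rewrite -powR_mulrn ?powR_ge0// -powRrM mulVf ?powRr1 ?ltW.
have L0 : 0 <= L by exact: powR_ge0.
have L2 : L ^+ 2 = a `^ (2 / 3).
  by rewrite -powR_mulrn ?powR_ge0// -powRrM mulrC.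
have RAE : RA A = Num.sqrt (1 + L ^+ 2) by rewrite L2.
exists L; first by rewrite ltNge; apply/negP => h; nra.
split => //; first by rewrite L3 /a mulrC divfK// gt_eqF.
rewrite /gamma RAE sqr_sqrtr ?addr_ge0 ?sqr_ge0// addrAC subrr add0r sqrtr_sqr ger0_norm//.
by rewrite mulrC mulrA mulfV ?mul1r// gt_eqF// pi_gt0.
Qed.

Theorem theorem9 (R : realType) (C : set 'rV[R]_4) (A : R)
  (Cbody : convex_body C) (Csym : symmetric_set C) (Crev : of_revolution C)
  (BC : closed_eball 0 1 `<=` C°)
  (Csec : forall H : set 'rV[R]_4,
    tangent_hyperplane H (closed_eball 0 1) -> vol3 H (C `&` H) = A%:E)
  (AAA : AA A) :
  exists (c : 'rV[R]_4) (r : R), 0 < r /\ C = closed_eball c r.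
Proof.
have [cC convC _] := Cbody.
have [A8 irr HC] := AAA.
have [L L2 [AE RAE gE]] := RA_tan A8.
have L0 : 0 < L by lra.
have clC : closed C by apply: compact_closed => //; exact: norm_hausdorff.
have [M CM] := compact_dot_bounded cC.
have BC' : [set x | dot x x <= 1] `<=` C°.
  by move=> x /= hx; apply: BC; rewrite /closed_eball /= subr0 enorm_le// expr1n.
have [eps eps0 Ceps] := dilated_ball cC BC'.
have C0 : C 0 by apply: Ceps; rewrite dot0l; exact: sqr_ge0.
have [e e1 turn] := axis_through_0 C0 CM Csym Crev.
have inv := revolution_invariant e1 turn.
have [v v1 [ve _]] := exists_unit_orthogonal e e.
have ev : dot e v = 0 by rewrite dotC.
(* The section of [C] by a plane through the axis; by rotation invariance the profile extracted from
   it describes the whole body. *)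
pose K (s t : R) := C (s *: e + t *: v).
have dotK s t : dot (s *: e + t *: v) (s *: e + t *: v) = s ^+ 2 + t ^+ 2.
  by rewrite !dotRE e1 v1 ev ve; ring.
have dotKe s t : dot (s *: e + t *: v) e = s by rewrite !dotRE e1 ve; ring.
have KN s t : K s t -> K s (- t).
  by apply: inv; rewrite ?dotK ?dotKe// sqrrN.
have Kopp s t : K s t -> K (- s) t.
  move=> /KN h; rewrite /K -Csym; exists (s *: e + (- t) *: v) => //.
  by apply/rowP => i; rewrite !mxE; ring.
have Kconv s t s' t' l : K s t -> K s' t' -> 0 <= l <= 1 ->
    K (l * s + (1 - l) * s') (l * t + (1 - l) * t').
  move=> h h' l01.
  case/andP: l01 => l0 l1.
  have := convC _ _ (Itv01 l0 l1) (@mem_set _ C _ h) (@mem_set _ C _ h').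
  rewrite inE /K => hc; suff <- : l *: (s *: e + t *: v) + (1 - l) *: (s' *: e + t' *: v) =
    (l * s + (1 - l) * s') *: e + (l * t + (1 - l) * t') *: v by exact: hc.
  by apply/rowP => i; rewrite !mxE; ring.
have Kbd s t : K s t -> s ^+ 2 + t ^+ 2 <= M ^+ 2 by move=> /CM; rewrite dotK.
have Kcl s t : (forall d, 0 < d ->
    exists s' t', [/\ `|s - s'| < d, `|t - t'| < d & K s' t']) -> K s t.
  exact: closed_plane_section.
have [q [mq Kq q01]] := profile_exists KN Kconv Kbd Kcl.
have dist0 x : 0 <= dot x x - dot x e ^+ 2.
  have := dot_ge0 (x - dot x e *: e); rewrite !dotRE e1 (dotC e x); lra.
have hC x : C x <-> dot x x - dot x e ^+ 2 <= q (dot x e).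
  rewrite -{1}(sqr_sqrtr (dist0 x)) -Kq.
  by split; apply: inv; rewrite ?dotKe ?dotK// sqr_sqrtr//; ring.
have qN s : q (- s) = q s.
  have le s' : q s' <= q (- s').
    have [->|q0] := q01 s'; first by have [->|] := q01 (- s'); lra.
    by rewrite -{1}(sqr_sqrtr q0); apply/Kq/Kopp/Kq; rewrite sqr_sqrtr.
  by apply/le_anti; rewrite le andbT -{2}[s]opprK le.
have sec t : (\int[@lebesgue_measure R]_z (pi * Num.max 0
    (q (cos t - z * sin t) - (sin t + z * cos t) ^+ 2))%:E = (4 / 3 * pi * L ^+ 3)%:E)%E.
  rewrite -AE -(section_volume t mq e1 v1 ev hC); apply: Csec; apply: tangent_hyperplane_ball.
  by rewrite dotK cos2Dsin2.
have Kball s t : s ^+ 2 + t ^+ 2 <= (1 + eps) ^+ 2 -> t ^+ 2 <= q s.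
  by move=> h; apply/Kq/Ceps; rewrite dotK.
have disc := @profile_disc R q L L0
  (fun s t s' t' l h h' hl => (Kq _ _).1 (Kconv _ _ _ _ _ ((Kq _ _).2 h) ((Kq _ _).2 h') hl))
  qN eps eps0 Kball M (fun s t h => Kbd s t ((Kq s t).2 h))
  (fun s t h => (Kq s t).1 (Kcl s t (fun d d0 =>
     let: ex_intro s' (ex_intro t' (And3 h1 h2 h3)) := h d d0 in
     ex_intro _ s' (ex_intro _ t' (And3 h1 h2 ((Kq s' t').2 h3))))))
  mq sec A RAE gE L2 irr HC.
set r := Num.sqrt (1 + L ^+ 2) in disc.
have r0 : 0 < r by rewrite sqrtr_gt0; have := sqr_ge0 L; lra.
have CE x : C x <-> dot x x <= r ^+ 2.
  rewrite hC -{1}(sqr_sqrtr (dist0 x)) disc sqr_sqrtr//.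
  by have -> : dot x e ^+ 2 + (dot x x - dot x e ^+ 2) = dot x x by ring.
exists 0, r; split => //; apply/seteqP.
by split => x; rewrite /closed_eball /= subr0 (enorm_le _ (ltW r0)) => /CE.
Qed.
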